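(* Let $s$ be a rational positive number or $s=\infty$. Then $\mathscr{A}_s$ is (topologically) isomorphic to a closed subalgebra of some holomorphically finitely generated (HFG) algebra.
   Context: Algebras are associative unital algebras over $\mathbb{C}$; homomorphisms and subalgebras are unital. The algebras $\mathscr{A}_s$. For $0\le s<\infty$, $$\mathscr{A}_s:=\Bigl\{a=\sum_{n=0}^\infty a_ny^n:\ \|a\|_{r,s}:=\sum_{n=0}^\infty|a_n|\frac{r^n}{n!^s}<\infty\ \ \forall r>0\Bigr\},$$ an algebra of formal power series in one variable $y$ (with multiplication of power series), topologized by the seminorms $\|\cdot\|_{r,s}$, $r>0$. Further, $\mathscr{A}_\infty:=\mathbb{C}[[y]]$ with the topology given by the seminorms $\|a\|_{m,\infty}:=\sum_{n=0}^m|a_n|$, $m\in\mathbb{Z}_+$. An Arens--Michael algebra is a complete (Hausdorff) locally convex algebra whose topology is generated by a family of submultiplicative seminorms ($\|ab\|\le\|a\|\,\|b\|$). The algebra of free entire functions with generators $\zeta_1,\dots,\zeta_m$ is $$\Bigl\{a=\sum_{\alpha\in W_m}c_\alpha\zeta_\alpha:\ \|a\|_\rho=\sum_{\alpha\in W_m}|c_\alpha|\rho^{|\alpha|}<\infty\ \ \forall\rho>0\Bigr\},\qquad c_\alpha\in\mathbb{C},$$ where $W_m$ is the set of all words (including the empty one) in the alphabet $\{1,\dots,m\}$, $|\alpha|$ is the length of $\alpha$, $\zeta_\alpha$ is the monomial corresponding to $\alpha$, the multiplication extends concatenation of words, and the topology is given by the norms $\|\cdot\|_\rho$. A Fréchet--Arens--Michael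 algebra is holomorphically finitely generated (HFG) if it is topologically isomorphic to the quotient of the algebra of free entire functions with finitely many generators by some closed two-sided ideal. *)

(* Defs.v *)
From HB Require Import structures.
From mathcomp Require Import all_boot all_order all_algebra.
From mathcomp Require Import ring_quotient.
From mathcomp Require Import all_classical all_reals all_analysis.
From mathcomp.real_closed Require Import complex.

Set Implicit Arguments.
Unset Strict Implicit.
Unset Printing Implicit Defensive.

Import Order.TTheory GRing.Theory Num.Theory.
Import numFieldNormedType.Exports.
Import ComplexField.

Local Open Scope classical_set_scope.
Local Open Scope ring_scope.
Local Open Scope complex_scope.

#[short(type="preTopologicalAlgType")]
HB.structure Definition PreTopologicalAlgebra (K : numDomainType) :=
  {A of Topological A & GRing.Algebra K A}.

HB.mixin Record hasContinuousMul A & Topological A & GRing.NzRing A := {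
  mul_continuous : continuous (fun x : A * A => x.1 * x.2)
}.

(* Library algebras satisfy 1 != 0, so the zero algebra is not represented;
   no nonzero algebra embeds into it as a unital subalgebra. *)
#[short(type="lcAlgType")]
HB.structure Definition LcAlgebra (K : numDomainType) :=
  {A of Tvs K A & GRing.Algebra K A & hasContinuousMul A}.

Definition top_alg_iso (K : numDomainType) (A B : preTopologicalAlgType K) :=
  exists (f : {lrmorphism A -> B}) (g : B -> A),
    [/\ cancel f g, cancel g f, continuous f & continuous g].

Section SeminormTopology.
Context {R : realType} {V : lmodType R[i]}.

Definition seminorm (p : V -> R) :=
  (forall x y, p (x + y) <= p x + p y) /\
  (forall (k : R[i]) x, p (k *: x) = Normc.normc k * p x).

Context {I : Type} (p : I -> V -> R).

Definition seminorm_ball (s : seq I) (e : R) (x : V) : set V :=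
  [set y | all (fun i => p i (y - x) < e) s].

Definition seminorm_nbhs (x : V) : set_system V :=
  [set U | exists (s : seq I) (e : R), 0 < e /\ seminorm_ball s e x `<=` U].

Hypothesis p_seminorm : forall i, seminorm (p i).

Lemma seminorm_ball_center s e x : 0 < e -> seminorm_ball s e x x.
Proof.
move=> e0; rewrite /seminorm_ball/= subrr; elim: s => //= i s ->.
by have [_ pZ] := p_seminorm i; rewrite -(scale0r 0) pZ Normc.normc0 mul0r e0.
Qed.

Lemma seminorm_nbhs_filter x : ProperFilter (seminorm_nbhs x).
Proof.
split.
  move=> [s [e [e0 sub]]]; exact: (sub x (seminorm_ball_center s x e0)).
split.
- by exists [::], 1; split.
- move=> U W [s [e [e0 sU]]] [t [d [d0 tW]]].
  exists (s ++ t), (Num.min e d); split; first by rewrite lt_min e0 d0.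
  move=> y; rewrite /seminorm_ball/= all_cat => /andP[ys yt]; split.
  + by apply: sU; apply: sub_all ys => i; rewrite lt_min => /andP[].
  + by apply: tW; apply: sub_all yt => i; rewrite lt_min => /andP[].
- move=> U W UW [s [e [e0 sU]]]; exists s, e; split => //.
  exact: subset_trans sU UW.
Qed.

Lemma seminorm_nbhs_singleton x U : seminorm_nbhs x U -> U x.
Proof. by move=> [s [e [e0 sU]]]; exact/sU/seminorm_ball_center. Qed.

Lemma seminorm_nbhs_nbhs x U :
  seminorm_nbhs x U -> seminorm_nbhs x (seminorm_nbhs^~ U).
Proof.
move=> [s [e [e0 sU]]]; exists s, (e / 2); split; first by rewrite divr_gt0.
move=> y ys; exists s, (e / 2); split; first by rewrite divr_gt0.
move=> z zs; apply: sU; move: ys zs; rewrite /seminorm_ball/=.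
elim: s => //= i s IH /andP[yi ys] /andP[zi zs]; apply/andP; split; last exact: IH.
have [pD _] := p_seminorm i.
have -> : z - x = (z - y) + (y - x) by rewrite addrA subrK.
by apply: (le_lt_trans (pD _ _)); rewrite [ltRHS](splitr e) ltrD.
Qed.

End SeminormTopology.

Definition generates_topology {R : realType} {A : preTopologicalLmodType R[i]}
    {I : Type} (p : I -> A -> R) :=
  forall x : A, nbhs x = seminorm_nbhs p x.

Lemma triangular_sum (V : nmodType) n (F : nat -> nat -> V) :
  \sum_(i < n.+1) \sum_(j < i.+1) F j (i - j)%N =
  \sum_(j < n.+1) \sum_(k < (n - j).+1) F j k.
Proof.
rewrite (eq_bigr (fun i : 'I_n.+1 => \sum_(j < n.+1 | (j < i.+1)%N) F j (i - j)%N));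
  last first.
  by move=> i _; rewrite (big_ord_widen n.+1 (fun j => F j (i - j)%N)).
rewrite (exchange_big_dep xpredT)//=; apply: eq_bigr => j _.
rewrite -(big_mkord (fun i => j < i.+1)%N (fun i => F j (i - j)%N)).
rewrite -[RHS](big_mkord xpredT).
rewrite (@big_cat_nat _ _ _ j)//=; last by rewrite ltnW.
rewrite big_nat_cond big_pred0 ?add0r; last first.
  by move=> i; rewrite ltnS; case: leqP => //= ij; rewrite ?andbF// ltnNge ij.
rewrite -{1}[nat_of_ord j]add0n big_addn subSn -1?ltnS//.
rewrite big_mkcond/=; apply: eq_bigr => i _.
by rewrite ltnS leq_addl addnK.
Qed.

Section Esum.
Context {R : realType}.
Local Open Scope ereal_scope.

Lemma esumZl (T : choiceType) (D : set T) (c : R) (f : T -> \bar R) :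
  (0 <= c)%R -> (forall i, 0 <= f i) ->
  \esum_(i in D) (c%:E * f i) = c%:E * \esum_(i in D) f i.
Proof.
have le (d : R) (g : T -> \bar R) : (0 <= d)%R -> (forall i, 0 <= g i) ->
    \esum_(i in D) (d%:E * g i) <= d%:E * \esum_(i in D) g i.
  move=> d0 g0; apply: ge_ereal_sup => _ [X [finX XD] <-].
  rewrite -ge0_mule_fsumr//; apply: lee_pmul => //; first by apply: fsume_ge0.
  by apply: ereal_sup_ubound; exists X.
rewrite le_eqVlt => /predU1P[<- f0|c0 f0].
  by rewrite mul0e esum1// => i _; rewrite mul0e.
apply/eqP; rewrite eq_le le ?(ltW c0)//=.
have c0' : (0 <= c^-1)%R by rewrite invr_ge0 ltW.
have cf0 i : 0 <= c%:E * f i by rewrite mule_ge0// lee_fin ltW.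
have := le _ _ c0' cf0.
under eq_esum => i _ do rewrite muleA -EFinM mulVf ?gt_eqF// mul1e.
rewrite -(@lee_pmul2l _ c%:E) ?lte_fin// muleA -EFinM divff ?gt_eqF// mul1e.
by [].

Qed.

Lemma esum_conv_lt (T : choiceType) (sz : T -> nat) (l r : nat -> T -> T)
    (u v : T -> R) :
  (forall w w' i i', (i <= sz w)%N -> (i' <= sz w')%N ->
     l i w = l i' w' -> r i w = r i' w' -> w = w' /\ i = i') ->
  (forall w, (0 <= u w)%R) -> (forall w, (0 <= v w)%R) ->
  \esum_(w in [set: T]) (u w)%:E < +oo ->
  \esum_(w in [set: T]) (v w)%:E < +oo ->
  \esum_(w in [set: T]) (\sum_(i < (sz w).+1) u (l i w) * v (r i w))%:E < +oo.
Proof.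
move=> inj u0 v0 uoo voo.
pose J w : set nat := `I_(sz w).+1.
pose a w i : \bar R := (u (l i w) * v (r i w))%:E.
have a0 w i : 0 <= a w i by rewrite lee_fin mulr_ge0.
pose b (x : T * T) : \bar R := (u x.1 * v x.2)%:E.
have b0 x : 0 <= b x by rewrite lee_fin mulr_ge0.
have -> : \esum_(w in [set: T]) (\sum_(i < (sz w).+1) u (l i w) * v (r i w))%:E =
          \esum_(w in [set: T]) \esum_(i in J w) a w i.
  apply: eq_esum => w _; rewrite esum_fset//; last exact: finite_II.
  rewrite -sumEFin -(big_mkord xpredT (a w)) big_mkord.
  by rewrite fsbig_ord.
rewrite esum_esum//.
pose e (x : T * nat) := (l x.2 x.1, r x.2 x.1).
have -> : \esum_(k in [set: T] `*`` J) a k.1 k.2 =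
          \esum_(x in e @` ([set: T] `*`` J)) b x.
  rewrite esum_image// => -[w i] [w' i'] /set_mem[/= _ wi] /set_mem[/= _ wi'].
  by case=> ll rr; have [-> ->] := inj w w' i i' wi wi' ll rr.
apply: (@le_lt_trans _ _ (\esum_(x in [set: T] `*`` (fun=> [set: T])) b x)).
  rewrite esum_mkcond [leRHS]esum_mkcond; apply: le_esum => x _.
  have -> : x \in [set: T] `*`` (fun=> [set: T]) by exact: mem_set.
  by case: ifP.
rewrite -(@esum_esum _ _ _ setT (fun=> setT) (fun x y => b (x, y)))//.
have vfin : \esum_(w in [set: T]) (v w)%:E \is a fin_num.
  by rewrite ge0_fin_numE// esum_ge0// => w _; rewrite lee_fin.
pose V := fine (\esum_(w in [set: T]) (v w)%:E).
rewrite (eq_esum (b := fun x => V%:E * (u x)%:E)); last first.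
  move=> x _; rewrite /b/=; under eq_esum do rewrite EFinM.
  by rewrite esumZl// muleC fineK.
have V0 : (0 <= V)%R by rewrite fine_ge0// esum_ge0// => w _; rewrite lee_fin.
rewrite esumZl//.
by rewrite lte_mul_pinfty// lee_fin.
Qed.

End Esum.

Section WeightedSums.
Context {R : realType} {T : choiceType}.
Local Notation normc := Normc.normc.
Implicit Types (W : T -> R) (a b : T -> R[i]).

Lemma normc_ge0 (z : R[i]) : 0 <= normc z.
Proof. by case: z => x y; exact: sqrtr_ge0. Qed.

Lemma normcD (x y : R[i]) : normc (x + y) <= normc x + normc y.
Proof. exact: le_normcD. Qed.

Lemma normc_sum n (F : 'I_n -> R[i]) :
  normc (\sum_(i < n) F i) <= \sum_(i < n) normc (F i).
Proof.
elim/big_ind2: _ => [|x x' y y' xx' yy'|//]; first by rewrite Normc.normc0.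
by apply: (le_trans (normcD _ _)); exact: lerD.
Qed.

Local Open Scope ereal_scope.

Definition wsum W a : \bar R := \esum_(w in [set: T]) (normc (a w) * W w)%:E.

Lemma wsum_ge0 W a : (forall w, 0 <= W w)%R -> 0 <= wsum W a.
Proof.
by move=> W0; apply: esum_ge0 => w _; rewrite lee_fin mulr_ge0// normc_ge0.
Qed.

Lemma wsumD W a b : (forall w, 0 <= W w)%R ->
  wsum W (fun w => a w + b w)%R <= wsum W a + wsum W b.
Proof.
move=> W0; rewrite /wsum -esumD; last 2 first.
- by move=> w _; rewrite lee_fin mulr_ge0// normc_ge0.
- by move=> w _; rewrite lee_fin mulr_ge0// normc_ge0.
apply: le_esum => w _; rewrite -EFinD lee_fin -mulrDl.
by apply: ler_wpM2r => //; exact: normcD.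
Qed.

Lemma wsumZ W (k : R[i]) a : (forall w, 0 <= W w)%R ->
  wsum W (fun w => k * a w)%R = (normc k)%:E * wsum W a.
Proof.
move=> W0; rewrite /wsum -esumZl ?normc_ge0//.
- by apply: eq_esum => w _; rewrite Normc.normcM -mulrA EFinM.
- by move=> w; rewrite lee_fin mulr_ge0// normc_ge0.
Qed.

Lemma wsum_point W a (t : T) : (forall w, 0 <= W w)%R ->
  (forall w, w != t -> a w = 0%R) -> wsum W a < +oo.
Proof.
move=> W0 at0; rewrite /wsum.
rewrite (_ : esum _ _ = \esum_(w in [set t]) (normc (a w) * W w)%:E).
  by rewrite esum_set1 ?ltry// lee_fin mulr_ge0// normc_ge0.
rewrite [RHS]esum_mkcond; apply: eq_esum => w _.
have [->|wt] := eqVneq w t; first by rewrite mem_set.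
rewrite memNset; first by rewrite at0// Normc.normc0 mul0r.
by move=> /= wt'; rewrite wt' eqxx in wt.
Qed.

Lemma wsum_conv W a b (sz : T -> nat) (l r : nat -> T -> T) :
  (forall w w' i i', (i <= sz w)%N -> (i' <= sz w')%N ->
     l i w = l i' w' -> r i w = r i' w' -> w = w' /\ i = i') ->
  (forall w, 0 <= W w)%R ->
  (forall w i, (i <= sz w)%N -> (W w <= W (l i w) * W (r i w))%R) ->
  wsum W a < +oo -> wsum W b < +oo ->
  wsum W (fun w => \sum_(i < (sz w).+1) a (l i w) * b (r i w))%R < +oo.
Proof.
move=> inj W0 WM aoo boo.
have := esum_conv_lt inj (u := fun w => (normc (a w) * W w)%R)
  (v := fun w => (normc (b w) * W w)%R).
move=> /(_ _ _ aoo boo) H; apply: le_lt_trans (H _ _); first last.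
- by move=> w; rewrite mulr_ge0// normc_ge0.
- by move=> w; rewrite mulr_ge0// normc_ge0.
apply: le_esum => w _; rewrite lee_fin.
apply: (le_trans (ler_wpM2r (W0 w) (normc_sum _))).
rewrite mulr_suml; apply: ler_sum => i _.
rewrite Normc.normcM mulrACA; apply: ler_wpM2l.
  by rewrite mulr_ge0// normc_ge0.
by apply: WM; rewrite -ltnS.
Qed.

End WeightedSums.

Section PowerSeries.

Definition powser (R : realType) : Type := nat -> R[i].

Context {R : realType}.

HB.instance Definition _ := GRing.Lmodule.copy (powser R) (nat -> R[i]).

Definition powser_one : powser R := fun n => (n == 0%N)%:R.

Definition powser_mul (a b : powser R) : powser R :=
  fun n => \sum_(i < n.+1) a i * b (n - i)%N.

Lemma powser_mulA : associative powser_mul.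
Proof.
move=> a b c; apply/funext => n; apply/esym; rewrite /powser_mul.
transitivity (\sum_(i < n.+1) \sum_(j < i.+1)
    a j * b (i - j)%N * c (n - (j + (i - j)))%N).
  apply: eq_bigr => i _; rewrite mulr_suml; apply: eq_bigr => j _.
  by rewrite subnKC// -ltnS.
rewrite (triangular_sum _ (fun j k => a j * b k * c (n - (j + k))%N)).
apply: eq_bigr => j _; rewrite mulr_sumr; apply: eq_bigr => k _.
by rewrite mulrA subnDA.
Qed.

Lemma powser_mul1r : left_id powser_one powser_mul.
Proof.
move=> a; apply/funext => n; rewrite /powser_mul big_ord_recl /= mul1r subn0.
by rewrite big1 ?addr0// => i _; rewrite /powser_one /= mul0r.
Qed.

Lemma powser_mulr1 : right_id powser_one powser_mul.
Proof.
move=> a; apply/funext => n; rewrite /powser_mul big_ord_recr /= subnn mulr1.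
rewrite big1 ?add0r// => i _; rewrite /powser_one subn_eq0 leqNgt ltn_ord /=.
by rewrite mulr0.
Qed.

Lemma powser_mulDl : left_distributive powser_mul +%R.
Proof.
move=> a b c; apply/funext => n.
transitivity (\sum_(i < n.+1) (a i + b i) * c (n - i)%N) => //.
transitivity (\sum_(i < n.+1) a i * c (n - i)%N + \sum_(i < n.+1) b i * c (n - i)%N) => //.
by rewrite -big_split; apply: eq_bigr => i _; rewrite mulrDl.
Qed.

Lemma powser_mulDr : right_distributive powser_mul +%R.
Proof.
move=> a b c; apply/funext => n.
transitivity (\sum_(i < n.+1) a i * (b (n - i)%N + c (n - i)%N)) => //.
transitivity (\sum_(i < n.+1) a i * b (n - i)%N + \sum_(i < n.+1) a i * c (n - i)%N) => //.
by rewrite -big_split; apply: eq_bigr => i _; rewrite mulrDr.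
Qed.

Lemma powser_one_neq0 : powser_one != 0.
Proof. by apply/eqP => /(congr1 (@^~ 0%N))/eqP; rewrite oner_eq0. Qed.

HB.instance Definition _ := GRing.Zmodule_isNzRing.Build (powser R)
  powser_mulA powser_mul1r powser_mulr1 powser_mulDl powser_mulDr
  powser_one_neq0.

Lemma powser_scaleAl (k : R[i]) (a b : powser R) : k *: (a * b) = (k *: a) * b.
Proof.
apply/funext => n.
transitivity (k * \sum_(i < n.+1) a i * b (n - i)%N) => //.
by rewrite mulr_sumr; apply: eq_bigr => i _; rewrite mulrA.
Qed.

HB.instance Definition _ :=
  GRing.Lmodule_isLalgebra.Build R[i] (powser R) powser_scaleAl.

Lemma powser_scaleAr (k : R[i]) (a b : powser R) : k *: (a * b) = a * (k *: b).
Proof.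
apply/funext => n.
transitivity (k * \sum_(i < n.+1) a i * b (n - i)%N) => //.
by rewrite mulr_sumr; apply: eq_bigr => i _; rewrite mulrCA.
Qed.

HB.instance Definition _ :=
  GRing.Lalgebra_isAlgebra.Build R[i] (powser R) powser_scaleAr.

Definition powser_norm (m : nat) (a : powser R) : R :=
  \sum_(n < m.+1) Normc.normc (a n).

Lemma powser_norm_seminorm m : seminorm (powser_norm m).
Proof.
split=> [a b|k a]; rewrite /powser_norm.
  by rewrite -big_split; apply: ler_sum => n _; exact: normcD.
by rewrite mulr_sumr; apply: eq_bigr => n _; rewrite -Normc.normcM.
Qed.

HB.instance Definition _ := hasNbhs.Build (powser R) (seminorm_nbhs powser_norm).
HB.instance Definition _ := Nbhs_isNbhsTopological.Build (powser R)
  (seminorm_nbhs_filter powser_norm_seminorm)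
  (seminorm_nbhs_singleton powser_norm_seminorm)
  (seminorm_nbhs_nbhs powser_norm_seminorm).

End PowerSeries.

Section WeightedPowerSeries.
Context {R : realType}.

Definition weight (s r : R) (n : nat) : R := r ^+ n / n`!%:R `^ s.

Definition weighted_norm (s r : R) (a : powser R) : \bar R :=
  (\sum_(0 <= n <oo) (Normc.normc (a n) * weight s r n)%:E)%E.

Definition weighted_summable (s : {nonneg R}) : {pred powser R} :=
  fun a => `[< forall r : R, 0 < r -> (weighted_norm s%:num r a < +oo)%E >].

Lemma weight_ge0 (s r : R) n : 0 < r -> 0 <= weight s r n.
Proof. by move=> r0; rewrite divr_ge0 ?powR_ge0// exprn_ge0// ltW. Qed.

Lemma weight_le (s r : R) n i : 0 <= s -> 0 < r -> (i <= n)%N ->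
  weight s r n <= weight s r i * weight s r (n - i).
Proof.
move=> s0 r0 le_in; rewrite /weight mulrACA -exprD subnKC//.
have f0 k : 0 < k`!%:R `^ s :> R by rewrite powR_gt0// ltr0n fact_gt0.
rewrite ler_wpM2l ?exprn_ge0 ?(ltW r0)// -invfM lef_pV2 ?posrE ?mulr_gt0//.
rewrite -powRM ?ler0n// -natrM ge0_ler_powR ?nnegrE ?ler0n// ler_nat.
by rewrite -(bin_fact le_in) leq_pmull// bin_gt0.
Qed.

Lemma weighted_normE (s r : R) a : 0 < r ->
  weighted_norm s r a = wsum (weight s r) a.
Proof.
move=> r0; rewrite /weighted_norm nneseries_esumT// => n.
by rewrite lee_fin mulr_ge0 ?normc_ge0// weight_ge0.
Qed.

Lemma weighted_summable_subalg (s : {nonneg R}) :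
  GRing.subsemialg_closed (weighted_summable s).
Proof.
split.
- apply/asboolP => r r0; rewrite weighted_normE//.
  apply: (wsum_point (t := 0%N)) => [w|w /negPf w0]; first exact: weight_ge0.
  by rewrite /GRing.one/= /powser_one w0.
- split=> [|a b /asboolP aS /asboolP bS]; apply/asboolP => r r0.
    rewrite weighted_normE//.
    by apply: (wsum_point (t := 0%N)) => // w; exact: weight_ge0.
  rewrite weighted_normE//; apply: le_lt_trans (wsumD _ _ _) _.
    by move=> w; exact: weight_ge0.
  by rewrite -!weighted_normE// lte_add_pinfty ?aS ?bS.
- move=> k a /asboolP aS; apply/asboolP => r r0.
  rewrite weighted_normE// (wsumZ k a); last by move=> w; exact: weight_ge0.
  by rewrite lte_mul_pinfty ?lee_fin ?normc_ge0// -weighted_normE// aS.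
- move=> a b /asboolP aS /asboolP bS; apply/asboolP => r r0.
  rewrite weighted_normE//.
  apply: (@wsum_conv _ _ _ a b id (fun i _ => i) (fun i n => n - i)%N).
  + move=> n n' i i' lei lei' ii' nn'; split => //.
    by rewrite -(subnKC lei) -(subnKC lei') nn' ii'.
  + by move=> w; exact: weight_ge0.
  + by move=> n i lei; exact: weight_le.
  + by rewrite -weighted_normE// aS.
  + by rewrite -weighted_normE// bS.
Qed.

HB.instance Definition _ (s : {nonneg R}) :=
  GRing.isSubalgClosed.Build R[i] (powser R) (weighted_summable s)
    (weighted_summable_subalg s).

Definition Afin (s : {nonneg R}) : Type :=
  {a : powser R | weighted_summable s a}.

HB.instance Definition _ (s : {nonneg R}) := SubType.on (Afin s).
HB.instance Definition _ (s : {nonneg R}) := [Choice of Afin s by <:].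
HB.instance Definition _ (s : {nonneg R}) :=
  [SubChoice_isSubAlgebra of Afin s by <:].

Definition Afin_norm (s : {nonneg R}) (r : {posnum R}) (a : Afin s) : R :=
  fine (weighted_norm s%:num r%:num (val a)).

Lemma Afin_norm_fin (s : {nonneg R}) (r : {posnum R}) (a : Afin s) :
  wsum (weight s%:num r%:num) (val a) \is a fin_num.
Proof.
rewrite ge0_fin_numE; last by apply: wsum_ge0 => w; exact: weight_ge0.
by rewrite -weighted_normE//; have /asboolP := valP a; apply.
Qed.

Lemma Afin_norm_seminorm (s : {nonneg R}) (r : {posnum R}) :
  seminorm (Afin_norm (s := s) r).
Proof.
have w0 n : 0 <= weight s%:num r%:num n by exact: weight_ge0.
split=> [a b|k a]; rewrite /Afin_norm !weighted_normE//.
  rewrite -fineD ?Afin_norm_fin// fine_le ?fin_numD ?Afin_norm_fin//.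
  by rewrite /= wsumD.
by rewrite [X in fine X](wsumZ k (val a)) // fineM ?Afin_norm_fin.
Qed.

HB.instance Definition _ (s : {nonneg R}) :=
  hasNbhs.Build (Afin s) (seminorm_nbhs (Afin_norm (s := s))).
HB.instance Definition _ (s : {nonneg R}) :=
  Nbhs_isNbhsTopological.Build (Afin s)
    (seminorm_nbhs_filter (Afin_norm_seminorm s))
    (seminorm_nbhs_singleton (Afin_norm_seminorm s))
    (seminorm_nbhs_nbhs (Afin_norm_seminorm s)).

(* None stands for s = oo. *)
Definition Aalg (s : option {nonneg R}) : preTopologicalAlgType R[i] :=
  if s is Some s' then Afin s' else powser R.

End WeightedPowerSeries.

Section FreeSeries.

Definition freeSeries (R : realType) (m : nat) : Type := seq 'I_m -> R[i].

Context {R : realType} {m : nat}.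
Local Notation S := (freeSeries R m).

HB.instance Definition _ := GRing.Lmodule.copy S (seq 'I_m -> R[i]).

Definition freeSeries_one : S := fun w => (w == [::])%:R.

(* The ways of writing w as a concatenation are w = take i w ++ drop i w with
   i <= size w. *)
Definition freeSeries_mul (a b : S) : S :=
  fun w => \sum_(i < (size w).+1) a (take i w) * b (drop i w).

Lemma freeSeries_mulA : associative freeSeries_mul.
Proof.
move=> a b c; apply/funext => w; apply/esym; rewrite /freeSeries_mul.
transitivity (\sum_(i < (size w).+1) \sum_(j < i.+1)
    a (take j w) * b (take (i - j) (drop j w)) * c (drop (j + (i - j)) w)).
  apply: eq_bigr => i _; rewrite mulr_suml.
  rewrite size_takel; last by rewrite -ltnS.
  apply: eq_bigr => j _.
  have ji : (j <= i)%N by rewrite -ltnS.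
  by rewrite take_takel// take_drop subnK// subnKC.
rewrite (triangular_sum _ (fun j k =>
  a (take j w) * b (take k (drop j w)) * c (drop (j + k) w))).
apply: eq_bigr => j _; rewrite mulr_sumr size_drop; apply: eq_bigr => k _.
by rewrite mulrA drop_drop addnC.
Qed.

Lemma freeSeries_mul1r : left_id freeSeries_one freeSeries_mul.
Proof.
move=> a; apply/funext => w; rewrite /freeSeries_mul big_ord_recl /=.
rewrite take0 drop0 mul1r big1 ?addr0// => i _; rewrite /freeSeries_one.
by case: w i => [|x w] i /=; [case: i|rewrite mul0r].
Qed.

Lemma freeSeries_mulr1 : right_id freeSeries_one freeSeries_mul.
Proof.
move=> a; apply/funext => w; rewrite /freeSeries_mul big_ord_recr /=.
rewrite take_size drop_size mulr1 big1 ?add0r// => i _; rewrite /freeSeries_one.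
by rewrite -size_eq0 size_drop subn_eq0 leqNgt ltn_ord mulr0.
Qed.

Lemma freeSeries_mulDl : left_distributive freeSeries_mul +%R.
Proof.
move=> a b c; apply/funext => w.
transitivity (\sum_(i < (size w).+1) (a (take i w) + b (take i w)) * c (drop i w)) => //.
transitivity (\sum_(i < (size w).+1) a (take i w) * c (drop i w) +
              \sum_(i < (size w).+1) b (take i w) * c (drop i w)) => //.
by rewrite -big_split; apply: eq_bigr => i _; rewrite mulrDl.
Qed.

Lemma freeSeries_mulDr : right_distributive freeSeries_mul +%R.
Proof.
move=> a b c; apply/funext => w.
transitivity (\sum_(i < (size w).+1) a (take i w) * (b (drop i w) + c (drop i w))) => //.
transitivity (\sum_(i < (size w).+1) a (take i w) * b (drop i w) +
              \sum_(i < (size w).+1) a (take i w) * c (drop i w)) => //.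
by rewrite -big_split; apply: eq_bigr => i _; rewrite mulrDr.
Qed.

Lemma freeSeries_one_neq0 : freeSeries_one != 0.
Proof. by apply/eqP => /(congr1 (@^~ [::]))/eqP; rewrite oner_eq0. Qed.

HB.instance Definition _ := GRing.Zmodule_isNzRing.Build S
  freeSeries_mulA freeSeries_mul1r freeSeries_mulr1 freeSeries_mulDl
  freeSeries_mulDr freeSeries_one_neq0.

Lemma freeSeries_scaleAl (k : R[i]) (a b : S) : k *: (a * b) = (k *: a) * b.
Proof.
apply/funext => w.
transitivity (k * \sum_(i < (size w).+1) a (take i w) * b (drop i w)) => //.
by rewrite mulr_sumr; apply: eq_bigr => i _; rewrite mulrA.
Qed.

HB.instance Definition _ :=
  GRing.Lmodule_isLalgebra.Build R[i] S freeSeries_scaleAl.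

Lemma freeSeries_scaleAr (k : R[i]) (a b : S) : k *: (a * b) = a * (k *: b).
Proof.
apply/funext => w.
transitivity (k * \sum_(i < (size w).+1) a (take i w) * b (drop i w)) => //.
by rewrite mulr_sumr; apply: eq_bigr => i _; rewrite mulrCA.
Qed.

HB.instance Definition _ :=
  GRing.Lalgebra_isAlgebra.Build R[i] S freeSeries_scaleAr.

Definition free_norm (rho : R) (a : S) : \bar R :=
  (\esum_(w in [set: seq 'I_m]) (Normc.normc (a w) * rho ^+ size w)%:E)%E.

Definition free_entire : {pred S} :=
  fun a => `[< forall rho : R, 0 < rho -> (free_norm rho a < +oo)%E >].

Lemma free_entire_subalg : GRing.subsemialg_closed free_entire.
Proof.
have W0 rho (w : seq 'I_m) : 0 < rho -> 0 <= rho ^+ size w :> R.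
  by move=> r0; rewrite exprn_ge0// ltW.
split.
- apply/asboolP => r r0; apply: (wsum_point (t := [::])) => [w|w /negPf w0].
    exact: W0.
  by rewrite /GRing.one/= /freeSeries_one w0.
- split=> [|a b /asboolP aS /asboolP bS]; apply/asboolP => r r0.
    by apply: (wsum_point (t := [::])) => // w; exact: W0.
  apply: le_lt_trans (wsumD _ _ _) _; first by move=> w; exact: W0.
  by apply: lte_add_pinfty; [exact: aS|exact: bS].
- move=> k a /asboolP aS; apply/asboolP => r r0.
  have -> : free_norm r (k *: a) = ((Normc.normc k)%:E * free_norm r a)%E.
    by apply: (wsumZ k a) => w; exact: W0.
  by rewrite lte_mul_pinfty ?lee_fin ?normc_ge0// aS.
- move=> a b /asboolP aS /asboolP bS; apply/asboolP => r r0.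
  apply: (@wsum_conv _ _ _ a b size take drop); last 2 first.
  + exact: aS.
  + exact: bS.
  + move=> w w' i i' lei lei' ii' ww'; split.
      by rewrite -(cat_take_drop i w) ii' ww' cat_take_drop.
    by rewrite -(size_takel lei) ii' size_takel.
  + by move=> w; exact: W0.
  + by move=> w i lei; rewrite -exprD size_takel// size_drop subnKC.
Qed.

HB.instance Definition _ :=
  GRing.isSubalgClosed.Build R[i] S free_entire free_entire_subalg.

End FreeSeries.

Section FreeEntire.

Definition freeEntire (R : realType) (m : nat) : Type :=
  {a : freeSeries R m | free_entire a}.

Context {R : realType} {m : nat}.

HB.instance Definition _ := SubType.on (freeEntire R m).
HB.instance Definition _ := [Choice of freeEntire R m by <:].
HB.instance Definition _ := [SubChoice_isSubAlgebra of freeEntire R m by <:].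

Definition freeEntire_norm (rho : {posnum R}) (a : freeEntire R m) : R :=
  fine (free_norm rho%:num (val a)).

Lemma freeEntire_norm_fin (rho : {posnum R}) (a : freeEntire R m) :
  free_norm rho%:num (val a) \is a fin_num.
Proof.
rewrite ge0_fin_numE; first by have /asboolP := valP a; apply.
by apply: wsum_ge0 => w; rewrite exprn_ge0.
Qed.

Lemma freeEntire_norm_seminorm rho : seminorm (freeEntire_norm rho).
Proof.
have w0 (w : seq 'I_m) : 0 <= rho%:num ^+ size w by rewrite exprn_ge0.
split=> [a b|k a]; rewrite /freeEntire_norm.
  rewrite -fineD ?freeEntire_norm_fin// fine_le ?fin_numD ?freeEntire_norm_fin//.
  exact: wsumD.
by rewrite [X in fine X](wsumZ k (val a)) // fineM ?freeEntire_norm_fin.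
Qed.

HB.instance Definition _ :=
  hasNbhs.Build (freeEntire R m) (seminorm_nbhs freeEntire_norm).
HB.instance Definition _ := Nbhs_isNbhsTopological.Build (freeEntire R m)
  (seminorm_nbhs_filter freeEntire_norm_seminorm)
  (seminorm_nbhs_singleton freeEntire_norm_seminorm)
  (seminorm_nbhs_nbhs freeEntire_norm_seminorm).

End FreeEntire.

HB.mixin Record isRightIdeal (A : nzRingType) (I : A -> bool) := {
  ideal_mulr_subproof : forall a, {in I, forall u, u * a \in I}
}.

(* The library's idealr is proper and closed under left multiplication only. *)
#[short(type="twoSidedIdeal")]
HB.structure Definition TwoSidedIdeal (A : nzRingType) :=
  {I of Idealr A I & isRightIdeal A I}.

Section QuotientAlgebra.
Local Open Scope quotient_scope.

Definition algQuotient (A : nzRingType) (I : twoSidedIdeal A) : Type :=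
  Quotient.quot I.

Section Ring.
Context {A : nzRingType} (I : twoSidedIdeal A).
Local Notation Q := (algQuotient I).

HB.instance Definition _ := EqQuotient.on Q.
HB.instance Definition _ := GRing.Zmodule.on Q.
HB.instance Definition _ := Quotient.copy Q (Quotient.quot I).

Lemma algQuotient_eq (x y : A) : (\pi_Q x == \pi_Q y) = (x - y \in I).
Proof. exact/esym/Quotient.idealrBE. Qed.

Lemma algQuotient_piD (x y : A) : \pi_Q (x + y) = \pi_Q x + \pi_Q y.
Proof. exact: (@pi_addr _ _ _ _ _ (Quotient.quot I)). Qed.

Definition algQuotient_one : Q := \pi_Q 1.
Definition algQuotient_mul := lift_op2 Q *%R.

Lemma algQuotient_piM (x y : A) :
  algQuotient_mul (\pi_Q x) (\pi_Q y) = \pi_Q (x * y).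
Proof.
unlock algQuotient_mul; apply/eqP; rewrite algQuotient_eq.
set x' := repr _; set y' := repr _.
have xx' : x' - x \in I by rewrite -algQuotient_eq reprK.
have yy' : y' - y \in I by rewrite -algQuotient_eq reprK.
have -> : x' * y' - x * y = x' * (y' - y) + (x' - x) * y.
  by rewrite mulrBr mulrBl addrA subrK.
apply: rpredD; first exact: idealMr.
exact: (@ideal_mulr_subproof _ I).
Qed.

Lemma algQuotient_mulA : associative algQuotient_mul.
Proof.
by move=> x y z; rewrite -[x]reprK -[y]reprK -[z]reprK !algQuotient_piM mulrA.
Qed.

Lemma algQuotient_mul1r : left_id algQuotient_one algQuotient_mul.
Proof. by move=> x; rewrite /algQuotient_one -[x]reprK algQuotient_piM mul1r. Qed.

Lemma algQuotient_mulr1 : right_id algQuotient_one algQuotient_mul.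
Proof. by move=> x; rewrite /algQuotient_one -[x]reprK algQuotient_piM mulr1. Qed.

Lemma algQuotient_mulDl : left_distributive algQuotient_mul +%R.
Proof.
move=> x y z; rewrite -[x]reprK -[y]reprK -[z]reprK.
by rewrite -algQuotient_piD !algQuotient_piM -algQuotient_piD mulrDl.
Qed.

Lemma algQuotient_mulDr : right_distributive algQuotient_mul +%R.
Proof.
move=> x y z; rewrite -[x]reprK -[y]reprK -[z]reprK.
by rewrite -algQuotient_piD !algQuotient_piM -algQuotient_piD mulrDr.
Qed.

Lemma algQuotient_one_neq0 : algQuotient_one != 0.
Proof.
have -> : 0 = \pi_Q 0.
  by apply: (addrI (\pi_Q 0)); rewrite addr0 -algQuotient_piD addr0.
by rewrite algQuotient_eq subr0 idealr1.
Qed.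

HB.instance Definition _ := GRing.Zmodule_isNzRing.Build Q
  algQuotient_mulA algQuotient_mul1r algQuotient_mulr1 algQuotient_mulDl
  algQuotient_mulDr algQuotient_one_neq0.
End Ring.

Section Algebra.
Context {K : nzRingType} {A : algType K} (I : twoSidedIdeal A).
Local Notation Q := (algQuotient I).

Definition algQuotient_scale (k : K) := lift_op1 Q ( *:%R k).

Lemma algQuotient_piZ k (x : A) :
  algQuotient_scale k (\pi_Q x) = \pi_Q (k *: x).
Proof.
unlock algQuotient_scale; apply/eqP; rewrite algQuotient_eq -scalerBr -mulr_algl.
by rewrite idealMr// -algQuotient_eq reprK.
Qed.

Lemma algQuotient_scaleA k l x :
  algQuotient_scale k (algQuotient_scale l x) = algQuotient_scale (k * l) x.
Proof. by rewrite -[x]reprK !algQuotient_piZ scalerA. Qed.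

Lemma algQuotient_scale1 : left_id 1 algQuotient_scale.
Proof. by move=> x; rewrite -[x]reprK algQuotient_piZ scale1r. Qed.

Lemma algQuotient_scaleDr : right_distributive algQuotient_scale +%R.
Proof.
move=> k x y; rewrite -[x]reprK -[y]reprK -algQuotient_piD !algQuotient_piZ.
by rewrite -algQuotient_piD scalerDr.
Qed.

Lemma algQuotient_scaleDl x : {morph algQuotient_scale^~ x : k l / k + l}.
Proof.
by move=> k l; rewrite -[x]reprK !algQuotient_piZ -algQuotient_piD scalerDl.
Qed.

HB.instance Definition _ := GRing.Zmodule_isLmodule.Build K Q
  algQuotient_scaleA algQuotient_scale1 algQuotient_scaleDr algQuotient_scaleDl.

Lemma algQuotient_scaleAl (k : K) (x y : Q) : k *: (x * y) = (k *: x) * y.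
Proof.
change (algQuotient_scale k (algQuotient_mul x y) =
        algQuotient_mul (algQuotient_scale k x) y).
by rewrite -[x]reprK -[y]reprK !(algQuotient_piM, algQuotient_piZ) scalerAl.
Qed.

HB.instance Definition _ :=
  GRing.Lmodule_isLalgebra.Build K Q algQuotient_scaleAl.

Lemma algQuotient_scaleAr (k : K) (x y : Q) : k *: (x * y) = x * (k *: y).
Proof.
change (algQuotient_scale k (algQuotient_mul x y) =
        algQuotient_mul x (algQuotient_scale k y)).
by rewrite -[x]reprK -[y]reprK !(algQuotient_piM, algQuotient_piZ) scalerAr.
Qed.

HB.instance Definition _ :=
  GRing.Lalgebra_isAlgebra.Build K Q algQuotient_scaleAr.
End Algebra.

Section Topology.
Context {K : numDomainType} {A : preTopologicalAlgType K} (I : twoSidedIdeal A).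
Local Notation Q := (algQuotient I).

(* The open sets of the library's quotient_topology; that alias is not reused
   because its choice structure differs from that of Quotient.quot. *)
Definition algQuotient_open : set_system Q := [set U | open (\pi_Q @^-1` U)].

Lemma algQuotient_openT : algQuotient_open setT.
Proof. by rewrite /algQuotient_open/= preimage_setT; exact: openT. Qed.

Lemma algQuotient_openI : setI_closed algQuotient_open.
Proof. by move=> U W oU oW; exact: openI. Qed.

Lemma algQuotient_open_bigU (J : Type) (f : J -> set Q) :
  (forall i, algQuotient_open (f i)) -> algQuotient_open (\bigcup_i f i).
Proof. by move=> of_; apply: bigcup_open => i _; exact: of_. Qed.

HB.instance Definition _ := isOpenTopological.Build Q
  algQuotient_openT algQuotient_openI algQuotient_open_bigU.
End Topology.
End QuotientAlgebra.

Section Subalgebra.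
Context {K : numDomainType} {B : preTopologicalAlgType K}.

Definition subalgebra (S : subalgClosed B) : Type := {x : B | x \in S}.

Context (S : subalgClosed B).
HB.instance Definition _ := SubType.on (subalgebra S).
HB.instance Definition _ := [Choice of subalgebra S by <:].
HB.instance Definition _ := [SubChoice_isSubAlgebra of subalgebra S by <:].
HB.instance Definition _ := Topological.copy (subalgebra S)
  (initial_topology (val : subalgebra S -> B)).
End Subalgebra.

Section HFG.
Context {R : realType}.

(* Cauchy filters of the additive topological group.  The library's cauchy is
   relative to the uniformity of the tvs structure, which is only required to
   be compatible with the topology, not with the addition. *)
Definition complete_space (V : preTopologicalLmodType R[i]) :=
  forall F : set_system V, ProperFilter F ->
    (fun z : V * V => z.1 - z.2) @ (F, F) --> (0 : V) ->
    exists x : V, F --> x.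

Definition submultiplicative (B : lcAlgType R[i]) (p : B -> R) :=
  forall a b, p (a * b) <= p a * p b.

Definition arens_michael (B : lcAlgType R[i]) :=
  [/\ complete_space B, hausdorff_space B &
    exists (I : Type) (p : I -> B -> R),
      [/\ forall i, seminorm (p i), forall i, submultiplicative (p i) &
        generates_topology p]].

Definition frechet (B : lcAlgType R[i]) :=
  [/\ complete_space B, hausdorff_space B &
    exists p : nat -> B -> R,
      (forall i, seminorm (p i)) /\ generates_topology p].

Definition hfg (B : lcAlgType R[i]) :=
  [/\ frechet B, arens_michael B &
    exists (m : nat) (I : twoSidedIdeal (freeEntire R m)),
      closed [set` I] /\ top_alg_iso (algQuotient I) B].

End HFG.

(* Main.v *)
Require Import Defs.
From HB Require Import structures.
From mathcomp Require Import all_boot all_order all_algebra.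
From mathcomp Require Import all_classical all_reals all_analysis.
From mathcomp.real_closed Require Import complex.
From mathcomp Require Import lra.

(** Why the theorem is true.  The algebra A_s is generated, topologically, by
one element y whose powers shrink like r^n / n!^s (or vanish in every
seminorm from some point on, when s = oo).  It embeds in a quotient of free
entire functions once y^n becomes a scalar multiple of a word whose length
grows linearly in n: the scalar then produces the decay.

Take four letters: an opening letter, a closing letter, a degree letter and a
weight letter.  A block is an opening letter, some degree and weight letters,
and a closing letter; with n degree letters and k weight letters it has the
value gamma n k.  A product of blocks has the product of their values, every
other word has value 0 (word_value).  Sending a word w to value(w) y^deg(w),
with deg(w) its number of degree letters, extends to a linear map from free
entire functions to power series, the symbol.  For s finite gamma n k = n!^s,
and the inequality n! p! <= (n + p)! makes the symbol continuous into A_s.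
For s = oo gamma n k = n^k: on power series truncated at degree m a block is
worth at most m^k, so the symbol is continuous for the product topology.

Let N be the set of f such that the symbol of u f v is zero for all u, v.  It
is the largest two-sided ideal on which the symbol vanishes, and it is closed.
In the quotient by N the class of gamma(n,k)^-1 times a block of degree n does
not depend on k, and these classes multiply as the powers of y: since the
delimiters isolate a block from its context, inserting it between u and v
multiplies the symbols (symbol_insert).  So the classes of the f with

  symbol (u f v) = f_0 symbol (u v) + symbol u (symbol f - f_0) symbol v

for all u and v, where f_0 is the constant coefficient of the symbol of f,
form a closed subalgebra (factorizes, closed_symbol_subalgebra), on which the
symbol induces an injective continuous homomorphism into A_s.  The formula
keeps f_0 apart because y^0 has to be the unit of the quotient and not a
block.

The inverse is continuous because a power series lifts to a combination of
blocks of small norm (lift_bound in block_embedding).  For s finite, words of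
length n + 2 with value n!^s give at once the seminorm of A_s.  For s = oo the
norm of gamma(n,k)^-1 times the block is rho^(n+k+2) / n^k, which is as small
as desired for n > rho and k large; so the tail of the series contributes
nothing and only finitely many coefficients matter.

It remains that the quotient of free entire functions by a closed two-sided
ideal is holomorphically finitely generated with the identity as the required
isomorphism (quotient_hfg): quotient seminorms are submultiplicative, and
completeness lifts from absolutely convergent series. *)

Set Implicit Arguments.
Unset Strict Implicit.
Unset Printing Implicit Defensive.

Import Order.TTheory GRing.Theory Num.Theory.
Import numFieldNormedType.Exports.

Local Open Scope classical_set_scope.
Local Open Scope ring_scope.

Local Notation normc := Normc.normc.

(** * Absolutely convergent complex sums over arbitrary index sets *)

Section AbsoluteSums.
Context {R : realType} {T : choiceType}.
Implicit Types (p q f g : T -> R) (a b : T -> R[i]).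

Local Notation Esum p := (\esum_(t in [set: T]) (p t)%:E)%E.

(** Only meaningful for absolutely summable [f]; the extended-real sums of the
positive and negative parts are then finite. *)
Definition real_sum f : R :=
  fine (Esum (fun t => Num.max (f t) 0)) - fine (Esum (fun t => Num.max (- f t) 0)).

Definition complex_sum a : R[i] :=
  (real_sum (fun t => complex.Re (a t)) +i* real_sum (fun t => complex.Im (a t)))%C.

Definition absolutely_summable a := (wsum (fun=> 1%R) a < +oo)%E.

Lemma Esum_fin p : (forall t, 0 <= p t) -> (Esum p < +oo)%E ->
  Esum p \is a fin_num.
Proof.
by move=> p0 poo; rewrite ge0_fin_numE// esum_ge0// => t _; rewrite lee_fin.
Qed.

Lemma Esum_le_lty p q : (forall t, p t <= q t) -> (Esum q < +oo)%E ->
  (Esum p < +oo)%E.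
Proof. by move=> pq; apply: le_lt_trans; apply: le_esum => t _; rewrite lee_fin. Qed.

(** Any decomposition into nonnegative summable parts computes the sum; this
is what makes linearity of [real_sum] immediate. *)
Lemma real_sumE p q f : (forall t, 0 <= p t) -> (forall t, 0 <= q t) ->
  (Esum p < +oo)%E -> (Esum q < +oo)%E -> (forall t, f t = p t - q t) ->
  real_sum f = fine (Esum p) - fine (Esum q).
Proof.
move=> p0 q0 poo qoo fE; rewrite /real_sum.
set u := fun t => Num.max (f t) 0; set v := fun t => Num.max (- f t) 0.
have u0 t : 0 <= u t by rewrite le_max lexx orbT.
have v0 t : 0 <= v t by rewrite le_max lexx orbT.
have uoo : (Esum u < +oo)%E.
  by apply: Esum_le_lty poo => t; rewrite ge_max fE p0 lerBlDr lerDl q0.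
have voo : (Esum v < +oo)%E.
  by apply: Esum_le_lty qoo => t; rewrite ge_max fE q0 opprB lerBlDr lerDl p0.
have : (Esum u + Esum q = Esum p + Esum v)%E.
  rewrite -!esumD => *; rewrite ?lee_fin//.
  apply: eq_esum => t _; rewrite -!EFinD; congr _%:E.
  rewrite /u /v !maxEle fE; case: ifPn; case: ifPn; lra.
move: (Esum_fin u0 uoo) (Esum_fin v0 voo) (Esum_fin p0 poo) (Esum_fin q0 qoo).
move=> /fineK <- /fineK <- /fineK <- /fineK <- /=.
by rewrite -!EFinD => -[]; lra.
Qed.

Lemma abs_split f : (Esum (fun t => `|f t|) < +oo)%E ->
  exists p q, [/\ forall t, 0 <= p t, forall t, 0 <= q t, (Esum p < +oo)%E,
    (Esum q < +oo)%E & forall t, f t = p t - q t].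
Proof.
move=> foo; exists (fun t => Num.max (f t) 0), (fun t => Num.max (- f t) 0).
split=> [t|t|||t]; rewrite ?le_max ?lexx ?orbT//.
- by apply: Esum_le_lty foo => t; rewrite ge_max ler_norm normr_ge0.
- by apply: Esum_le_lty foo => t; rewrite ge_max -normrN ler_norm normr_ge0.
- by rewrite !maxEle; case: ifPn; case: ifPn; lra.
Qed.

Lemma real_sumD f g : (Esum (fun t => `|f t|) < +oo)%E ->
  (Esum (fun t => `|g t|) < +oo)%E ->
  real_sum (fun t => f t + g t) = real_sum f + real_sum g.
Proof.
move=> /abs_split[p [q [p0 q0 poo qoo fE]]] /abs_split[u [v [u0 v0 uoo voo gE]]].
rewrite (real_sumE p0 q0 poo qoo fE) (real_sumE u0 v0 uoo voo gE).
have ED p' q' : (forall t, 0 <= p' t) -> (forall t, 0 <= q' t) ->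
    Esum (fun t => p' t + q' t) = (Esum p' + Esum q')%E.
  by move=> ? ?; rewrite -esumD// => *; rewrite lee_fin.
rewrite (real_sumE (p := fun t => p t + u t) (q := fun t => q t + v t)).
- by rewrite !ED// !fineD ?Esum_fin//; lra.
- by move=> t; rewrite addr_ge0.
- by move=> t; rewrite addr_ge0.
- by rewrite ED// lte_add_pinfty.
- by rewrite ED// lte_add_pinfty.
- by move=> t; rewrite fE gE; lra.
Qed.

Lemma real_sumZ (k : R) f : (Esum (fun t => `|f t|) < +oo)%E ->
  real_sum (fun t => k * f t) = k * real_sum f.
Proof.
move=> /abs_split[p [q [p0 q0 poo qoo fE]]].
have EZ c p' : 0 <= c -> (forall t, 0 <= p' t) ->
    Esum (fun t => c * p' t) = (c%:E * Esum p')%E.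
  by move=> c0 p'0; rewrite -esumZl// => *; rewrite lee_fin.
wlog k0 : k f p q p0 q0 poo qoo fE / 0 <= k => [wl|].
  have [k0|k0] := leP 0 k; first exact: (wl k f p q).
  have fNE t : - f t = q t - p t by rewrite fE opprB.
  rewrite (real_sumE p0 q0 poo qoo fE) -opprB mulrN -mulNr.
  rewrite -(real_sumE q0 p0 qoo poo fNE) -(wl _ _ q p)//; last first.
    by rewrite oppr_ge0 ltW.
  by congr real_sum; apply/funext => t; rewrite mulrNN.
rewrite (real_sumE p0 q0 poo qoo fE).
rewrite (real_sumE (p := fun t => k * p t) (q := fun t => k * q t)).
- by rewrite !EZ// !fineM ?Esum_fin//= mulrBr.
- by move=> t; rewrite mulr_ge0.
- by move=> t; rewrite mulr_ge0.
- by rewrite EZ// lte_mul_pinfty// lee_fin.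
- by rewrite EZ// lte_mul_pinfty// lee_fin.
- by move=> t; rewrite fE mulrBr.
Qed.

Lemma real_sum_le f : (Esum (fun t => `|f t|) < +oo)%E ->
  `|real_sum f| <= fine (Esum (fun t => `|f t|)).
Proof.
move=> foo; rewrite /real_sum.
set u := fun t => Num.max (f t) 0; set v := fun t => Num.max (- f t) 0.
have u0 t : 0 <= u t by rewrite le_max lexx orbT.
have v0 t : 0 <= v t by rewrite le_max lexx orbT.
have uoo : (Esum u < +oo)%E.
  by apply: Esum_le_lty foo => t; rewrite ge_max ler_norm normr_ge0.
have voo : (Esum v < +oo)%E.
  by apply: Esum_le_lty foo => t; rewrite ge_max -normrN ler_norm normr_ge0.
have -> : Esum (fun t => `|f t|) = (Esum u + Esum v)%E.
  rewrite -esumD => *; rewrite ?lee_fin//.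
  apply: eq_esum => t _; rewrite -!EFinD; congr _%:E.
  rewrite /u /v; have /orP[f0|f0] := le_total 0 (f t).
    have f1 : - f t <= 0 by rewrite oppr_le0.
    by rewrite ger0_norm// (max_l f0) (max_r f1) addr0.
  have f1 : 0 <= - f t by rewrite oppr_ge0.
  by rewrite ler0_norm// (max_r f0) (max_l f1) add0r.
rewrite fineD ?Esum_fin//.
have fu : 0 <= fine (Esum u) by rewrite fine_ge0// esum_ge0// => *; rewrite lee_fin.
have fv : 0 <= fine (Esum v) by rewrite fine_ge0// esum_ge0// => *; rewrite lee_fin.
by rewrite ler_norml; apply/andP; split; lra.
Qed.

Lemma normc_Re_Im (z : R[i]) : normc z <= `|complex.Re z| + `|complex.Im z|.
Proof.
case: z => x y /=; rewrite -[leRHS]ger0_norm ?addr_ge0// -sqrtr_sqr.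
rewrite ler_sqrt ?sqr_ge0// sqrrD !real_normK ?num_real// -addrA lerD2l lerDr.
by rewrite mulrn_wge0// mulr_ge0.
Qed.

Lemma Re_le_normc (z : R[i]) : `|complex.Re z| <= normc z.
Proof.
case: z => x y /=.
by rewrite -sqrtr_sqr ler_sqrt ?addr_ge0 ?sqr_ge0// lerDl sqr_ge0.
Qed.

Lemma Im_le_normc (z : R[i]) : `|complex.Im z| <= normc z.
Proof.
case: z => x y /=.
by rewrite -sqrtr_sqr ler_sqrt ?addr_ge0 ?sqr_ge0// lerDr sqr_ge0.
Qed.

Lemma wsum1E a : wsum (fun=> 1%R) a = Esum (fun t => normc (a t)).
Proof. by apply: eq_esum => t _; rewrite mulr1. Qed.

Lemma summable_Re a : absolutely_summable a ->
  (Esum (fun t => `|complex.Re (a t)|) < +oo)%E.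
Proof.
by rewrite /absolutely_summable wsum1E; apply: Esum_le_lty => t; exact: Re_le_normc.
Qed.

Lemma summable_Im a : absolutely_summable a ->
  (Esum (fun t => `|complex.Im (a t)|) < +oo)%E.
Proof.
by rewrite /absolutely_summable wsum1E; apply: Esum_le_lty => t; exact: Im_le_normc.
Qed.

Lemma complex_sumD a b : absolutely_summable a -> absolutely_summable b ->
  complex_sum (fun t => a t + b t) = complex_sum a + complex_sum b.
Proof.
move=> aS bS; rewrite /complex_sum; apply/eqP; rewrite eq_complex /=.
rewrite -real_sumD ?summable_Re// -real_sumD ?summable_Im//.
by apply/andP; split; apply/eqP; congr real_sum; apply/funext => t; rewrite raddfD.
Qed.

Lemma absolutely_summableZ (k : R[i]) a :
  absolutely_summable a -> absolutely_summable (fun t => k * a t).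
Proof.
by move=> aS; rewrite /absolutely_summable wsumZ// lte_mul_pinfty ?lee_fin ?normc_ge0.
Qed.

Lemma complex_sumZ (k : R[i]) a : absolutely_summable a ->
  complex_sum (fun t => k * a t) = k * complex_sum a.
Proof.
move=> aS; case: k => x y; rewrite /complex_sum; apply/eqP; rewrite eq_complex /=.
have rS c : (Esum (fun t => `|c * complex.Re (a t)|) < +oo)%E.
  under eq_esum do rewrite normrM EFinM.
  by rewrite esumZl// lte_mul_pinfty// ?lee_fin// summable_Re.
have iS c : (Esum (fun t => `|c * complex.Im (a t)|) < +oo)%E.
  under eq_esum do rewrite normrM EFinM.
  by rewrite esumZl// lte_mul_pinfty// ?lee_fin// summable_Im.
apply/andP; split; apply/eqP.
- rewrite -mulNr -(real_sumZ x (summable_Re aS)) -(real_sumZ (- y) (summable_Im aS)).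
  rewrite -real_sumD//.
  by congr real_sum; apply/funext => t; case: (a t) => u v /=; rewrite mulNr.
- rewrite -(real_sumZ x (summable_Im aS)) -(real_sumZ y (summable_Re aS)).
  rewrite -real_sumD//.
  by congr real_sum; apply/funext => t; case: (a t).
Qed.

(** The constant 2 comes from bounding the real and imaginary parts
separately; it is harmless since only continuity is drawn from the bound. *)
Lemma complex_sum_le a : absolutely_summable a ->
  normc (complex_sum a) <= 2 * fine (wsum (fun=> 1%R) a).
Proof.
move=> aS; apply: (le_trans (normc_Re_Im _)) => /=.
rewrite mulr2n mulrDl mul1r; apply: lerD.
- apply: (le_trans (real_sum_le (summable_Re aS))); rewrite fine_le//.
  + by rewrite Esum_fin// summable_Re.
  + by rewrite ge0_fin_numE// wsum_ge0.
  + by rewrite wsum1E; apply: le_esum => t _; rewrite lee_fin Re_le_normc.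
- apply: (le_trans (real_sum_le (summable_Im aS))); rewrite fine_le//.
  + by rewrite Esum_fin// summable_Im.
  + by rewrite ge0_fin_numE// wsum_ge0.
  + by rewrite wsum1E; apply: le_esum => t _; rewrite lee_fin Im_le_normc.
Qed.

Lemma Esum_point p t0 : 0 <= p t0 -> (forall t, t != t0 -> p t = 0) ->
  Esum p = (p t0)%:E.
Proof.
move=> p0 pz; rewrite -(@esum_set1 _ _ t0 (fun t => (p t)%:E)) ?lee_fin//.
rewrite [RHS]esum_mkcond; apply: eq_esum => t _.
have [->|tt0] := eqVneq t t0; first by rewrite mem_set.
by rewrite pz// memNset// => /= /eqP; rewrite (negPf tt0).
Qed.

Lemma complex_sum_point a t0 : (forall t, t != t0 -> a t = 0) ->
  complex_sum a = a t0.
Proof.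
move=> az; suff rp f : (forall t, t != t0 -> f t = 0) -> real_sum f = f t0.
  rewrite /complex_sum !rp => [|t /az->|t /az->]//.
  by case: (a t0).
move=> fz; rewrite /real_sum !(@Esum_point _ t0)/= ?le_max ?lexx ?orbT//.
- by rewrite !maxEle; case: ifPn; case: ifPn; lra.
- by move=> t /fz ->; rewrite oppr0 maxxx.
- by move=> t /fz ->; rewrite maxxx.
Qed.

End AbsoluteSums.

Lemma complex_sum_recl {R : realType} (a : nat -> R[i]) :
  absolutely_summable a ->
  complex_sum a = a 0%N + complex_sum (fun n => a n.+1).
Proof.
move=> aS.
have Sinj : set_inj [set: nat] succn by move=> ? ? _ _ [].
have Eshift (p : nat -> R) : p 0%N = 0 ->
    (\esum_(t in [set: nat]) (p t)%:E = \esum_(t in [set: nat]) (p t.+1)%:E)%E.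
  move=> p0; rewrite -(@esum_image _ _ _ setT succn (fun t => (p t)%:E) Sinj).
  rewrite [RHS]esum_mkcond.
  apply: eq_esum => -[_|n _]; first by case: ifP => //; rewrite p0.
  by rewrite mem_set//; exists n.
pose b n := if n is n'.+1 then a n else 0.
pose c n := if n is n'.+1 then 0 else a n.
have cbE : a = (fun n => c n + b n).
  by apply/funext => -[|n]; rewrite /b /c ?addr0 ?add0r.
have cS : absolutely_summable c.
  apply: (wsum_point (t := 0%N)) => [n|n]; first by rewrite ler01.
  by case: n.
have bS : absolutely_summable b.
  apply: le_lt_trans aS; apply: le_esum => n _; rewrite lee_fin !mulr1.
  by case: n => [|n] //; rewrite /b Normc.normc0 normc_ge0.
rewrite [in LHS]cbE complex_sumD// (complex_sum_point (t0 := 0%N)); last by case.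
congr (_ + _).
suff rs (f : nat -> R) : f 0%N = 0 -> real_sum f = real_sum (fun n => f n.+1).
  by rewrite /complex_sum (rs (fun n => complex.Re (b n)))//
    (rs (fun n => complex.Im (b n))).
move=> f0; rewrite /real_sum (Eshift (fun t => Num.max (f t) 0)); last first.
  by rewrite f0 maxxx.
by rewrite (Eshift (fun t => Num.max (- f t) 0))// f0 oppr0 maxxx.
Qed.

(** * Topologies generated by seminorms *)

Section SeminormedSpaces.
Context {R : realType}.

Section SeminormTheory.
Context {V : lmodType R[i]} (p : V -> R).
Hypothesis pS : seminorm p.

Lemma seminormD x y : p (x + y) <= p x + p y. Proof. exact: pS.1. Qed.

Lemma seminormZ (k : R[i]) x : p (k *: x) = normc k * p x.
Proof. exact: pS.2. Qed.

Lemma seminorm0 : p 0 = 0.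
Proof. by rewrite -(scale0r 0) seminormZ Normc.normc0 mul0r. Qed.

Lemma seminormN x : p (- x) = p x.
Proof. by rewrite -scaleN1r seminormZ normcN Normc.normc1 mul1r. Qed.

Lemma seminorm_ge0 x : 0 <= p x.
Proof.
have := seminormD x (- x); rewrite subrr seminorm0 seminormN -mulr2n.
by rewrite pmulrn_lge0.
Qed.

Lemma seminormB x y : p (x - y) = p (y - x).
Proof. by rewrite -opprB seminormN. Qed.

End SeminormTheory.

Section SeminormTopology.
Context {V : preTopologicalLmodType R[i]} {I : Type} (p : I -> V -> R).
Hypothesis pS : forall i, seminorm (p i).
Hypothesis pV : generates_topology p.

Lemma near_seminorm x i e : 0 < e -> \forall y \near x, p i (y - x) < e.
Proof.
move=> e0; change (nbhs x [set y | p i (y - x) < e]).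
rewrite pV; exists [:: i], e; split => // y.
by rewrite /seminorm_ball /= andbT.
Qed.

Lemma cvg_seminorm (T : Type) (F : set_system T) (f : T -> V) (x : V) :
  Filter F -> (forall i e, 0 < e -> \forall t \near F, p i (f t - x) < e) ->
  f @ F --> x.
Proof.
move=> FF fx U; rewrite pV => -[s [e [e0 sU]]].
suff : \forall t \near F, all (fun i => p i (f t - x) < e) s.
  by apply: filterS => t ts; exact: sU.
elim: s {sU} => [|i s IH]; first exact: nearW.
near=> t; apply/andP; split; last by near: t.
by near: t; exact: fx.
Unshelve. all: by end_near. Qed.

Lemma seminorm_add_continuous : continuous (fun z : V * V => z.1 + z.2).
Proof.
case=> x y; apply: cvg_seminorm => i e e0.
have e2 : 0 < e / 2 by rewrite divr_gt0.
near=> z => /=; rewrite opprD addrACA (splitr e).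
apply: le_lt_trans (seminormD (pS i) _ _) _; apply: ltrD.
- by near: z; apply: (cvg_fst (near_seminorm x i e2)).
- by near: z; apply: (cvg_snd (near_seminorm y i e2)).
Unshelve. all: by end_near. Qed.

Lemma near_normc (k : R[i]^o) e : 0 < e -> \forall l \near k, normc (l - k) < e.
Proof.
move=> e0; have e0' : 0 < e%:C%C by rewrite ltcR.
near=> l; rewrite -ltcR -[X in X < _]/`|l - k| distrC.
by near: l; exact: (@nbhsx_ballx _ _ k _ e0').
Unshelve. all: by end_near. Qed.

Lemma seminorm_scale_continuous :
  continuous (fun z : R[i]^o * V => z.1 *: z.2).
Proof.
case=> k x; apply: cvg_seminorm => i e e0.
have pi0 := seminorm_ge0 (pS i).
have e1 : 0 < Num.min 1 (e / 2 / (p i x + 1)).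
  by rewrite lt_min ltr01 !divr_gt0// ltr_wpDl.
have k0 : 0 < normc k + 1 by rewrite ltr_wpDl ?normc_ge0.
have e2 : 0 < e / 2 / (normc k + 1) by rewrite !divr_gt0.
near=> z => /=.
have zk : normc (z.1 - k) < Num.min 1 (e / 2 / (p i x + 1)).
  by near: z; apply: (cvg_fst (near_normc k e1)).
have zx : p i (z.2 - x) < e / 2 / (normc k + 1).
  by near: z; apply: (cvg_snd (near_seminorm x i e2)).
have -> : z.1 *: z.2 - k *: x = z.1 *: (z.2 - x) + (z.1 - k) *: x.
  by rewrite scalerBr scalerBl addrA subrK.
apply: le_lt_trans (seminormD (pS i) _ _) _; rewrite !seminormZ// (splitr e).
move: zk; rewrite lt_min => /andP[zk1 zk2].
apply: ltr_leD; last first.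
  apply: (@le_trans _ _ (e / 2 / (p i x + 1) * (p i x + 1))).
    by apply: ler_pM; [exact: normc_ge0|exact: pi0|exact: ltW|rewrite lerDl ler01].
  by rewrite divfK// gt_eqF// ltr_wpDl.
apply: (@le_lt_trans _ _ ((normc k + 1) * p i (z.2 - x))).
  apply: ler_wpM2r => //; rewrite -(subrK k z.1) addrC.
  by apply: (le_trans (normcD _ _)); rewrite lerD2l ltW.
by rewrite mulrC -ltr_pdivlMr.
Unshelve. all: by end_near. Qed.

Lemma seminorm_ball_open s e x : open (seminorm_ball p s e x).
Proof.
rewrite openE => y ys; rewrite /interior.
suff : \forall z \near y, all (fun i => p i (z - x) < e) s by [].
elim: s ys => [|i s IH]; first by move=> _; exact: nearW.
rewrite /seminorm_ball /= => /andP[iy sy].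
have h : 0 < e - p i (y - x) by rewrite subr_gt0.
near=> z; apply/andP; split; last by near: z; exact: IH.
have -> : z - x = (z - y) + (y - x) by rewrite addrA subrK.
apply: le_lt_trans (seminormD (pS i) _ _) _; rewrite -ltrBrDr.
by near: z; exact: near_seminorm.
Unshelve. all: by end_near. Qed.

(** The finite intersections of seminorm balls form the convex basis. A weight
[l] in the complex interval from 0 to 1 is real, so that the moduli of [l] and
[1 - l] add up to 1. *)
Lemma seminorm_locally_convex : exists2 B : set_system V,
  (forall b, b \in B -> convex_set b) & basis B.
Proof.
exists [set b | exists s e x, b = seminorm_ball p s e x].
  move=> _ /set_mem[s [e [x ->]]] y z l /set_mem ys /set_mem zs; apply/mem_set.
  elim: s ys zs => // i s IH /andP[yi ys] /andP[zi zs].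
  apply/andP; split; last exact: IH.
  have norm1 : normc l%:num + normc (1 - l%:num) = 1.
    apply: complexI; rewrite rmorphD /= -[(normc _)%:C%C]/`|l%:num|.
    rewrite -[(normc (_ - _))%:C%C]/`|1 - l%:num| !ger0_norm ?subr_ge0//.
    by rewrite addrC subrK.
  have -> : l%:num *: y + (1 - l%:num) *: z - x =
      l%:num *: (y - x) + (1 - l%:num) *: (z - x).
    by rewrite !scalerBr addrACA -opprD -scalerDl [l%:num + _]addrC subrK scale1r.
  apply: le_lt_trans (seminormD (pS i) _ _) _; rewrite !seminormZ//.
  rewrite -[e]mul1r -norm1 mulrDl.
  have [l0|l0] := eqVneq (normc l%:num) 0.
    rewrite l0 !mul0r !add0r; move: norm1; rewrite l0 add0r => ->.
    by rewrite !mul1r.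
  apply: ltr_leD.
    by rewrite ltr_pM2l// lt_neqAle eq_sym l0 normc_ge0.
  by apply: ler_wpM2l; [exact: normc_ge0|exact: ltW].
split; first by move=> _ [s [e [x ->]]]; exact: seminorm_ball_open.
move=> x U; rewrite pV => -[s [e [e0 sU]]].
exists (seminorm_ball p s e x) => //; split; first by exists s, e, x.
exact: seminorm_ball_center.
Qed.

Lemma seminorm_hausdorff : (forall x, (forall i, p i x = 0) -> x = 0) ->
  hausdorff_space V.
Proof.
move=> sep x y xy; apply/eqP; rewrite -subr_eq0; apply/eqP/sep => i.
apply/eqP; rewrite eq_le seminorm_ge0// andbT; apply/ler_addgt0Pl => e e0.
have e2 : 0 < e / 2 by rewrite divr_gt0.
have [z [zx zy]] := xy _ _ (near_seminorm x i e2) (near_seminorm y i e2).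
rewrite addr0 (splitr e).
have -> : x - y = (x - z) + (z - y) by rewrite addrA subrK.
apply: le_trans (seminormD (pS i) _ _) _; apply: lerD; last exact: ltW.
by rewrite seminormB// ltW.
Qed.

End SeminormTopology.

Lemma seminorm_mul_continuous (A : preTopologicalAlgType R[i]) (I : Type)
    (p : I -> A -> R) : (forall i, seminorm (p i)) -> generates_topology p ->
  (forall i x y, p i (x * y) <= p i x * p i y) ->
  continuous (fun z : A * A => z.1 * z.2).
Proof.
move=> pS pV pM [x y]; apply: (cvg_seminorm pV) => i e e0.
have pi0 := seminorm_ge0 (pS i).
have e1 : 0 < Num.min 1 (e / 2 / (p i y + 1)).
  by rewrite lt_min ltr01 !divr_gt0// ltr_wpDl.
have k0 : 0 < p i x + 1 by rewrite ltr_wpDl.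
have e2 : 0 < e / 2 / (p i x + 1) by rewrite !divr_gt0.
near=> z => /=.
have zk : p i (z.1 - x) < Num.min 1 (e / 2 / (p i y + 1)).
  by near: z; apply: (cvg_fst (near_seminorm pV x i e1)).
have zx : p i (z.2 - y) < e / 2 / (p i x + 1).
  by near: z; apply: (cvg_snd (near_seminorm pV y i e2)).
have -> : z.1 * z.2 - x * y = z.1 * (z.2 - y) + (z.1 - x) * y.
  by rewrite mulrBr mulrBl addrA subrK.
apply: le_lt_trans (seminormD (pS i) _ _) _; rewrite (splitr e).
move: zk; rewrite lt_min => /andP[zk1 zk2].
apply: ltr_leD; last first.
  apply: (le_trans (pM _ _ _)).
  apply: (@le_trans _ _ (e / 2 / (p i y + 1) * (p i y + 1))).
    by apply: ler_pM; [exact: pi0|exact: pi0|exact: ltW|rewrite lerDl ler01].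
  by rewrite divfK// gt_eqF// ltr_wpDl.
apply: (le_lt_trans (pM _ _ _)).
apply: (@le_lt_trans _ _ ((p i x + 1) * p i (z.2 - y))).
  apply: ler_wpM2r => //; rewrite -(subrK x z.1) addrC.
  by apply: (le_trans (seminormD (pS i) _ _)); rewrite lerD2l ltW.
by rewrite mulrC -ltr_pdivlMr.
Unshelve. all: by end_near. Qed.

End SeminormedSpaces.

(** * Norms and series of free entire functions *)

Section EsumInterchange.
Context {R : realType}.
Local Open Scope ereal_scope.

Lemma esum_interchange (S T : choiceType) (a : S -> T -> \bar R) :
  (forall x y, 0 <= a x y) ->
  \esum_(x in [set: S]) \esum_(y in [set: T]) a x y =
  \esum_(y in [set: T]) \esum_(x in [set: S]) a x y.
Proof.
move=> a0; rewrite !esum_esum//.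
rewrite (@reindex_esum _ _ _ ([set: T] `*`` fun=> [set: S]) _
  (fun z : T * S => (z.2, z.1)))//.
split=> //; first by move=> [? ?] [? ?] _ _ /= [-> ->].
by move=> [x y] _; exists (y, x).
Qed.

Lemma esum_half_power n :
  \esum_(k in [set: nat]) ((2^-1) ^+ (n + k).+1)%:E <= ((2^-1) ^+ n : R)%:E.
Proof.
rewrite -nneseries_esumT; last by move=> k; rewrite lee_fin exprn_ge0.
apply: le_trans (epsilon_trick0 xpredT (exprn_ge0 n _)) => //.
rewrite le_eqVlt; apply/orP; left; apply/eqP; apply: eq_eseriesr => k _.
by congr _%:E; rewrite -addnS exprD natrX -[in RHS]exprVn.
Qed.

(** Cutting a word at a position is injective from pairs (word, position) to
pairs of words; this is the submultiplicativity of weighted l1 norms. *)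
Lemma esum_take_drop_le (T : choiceType) (u v : seq T -> R) :
  (forall w, 0 <= u w)%R -> (forall w, 0 <= v w)%R ->
  \esum_(w in [set: seq T])
      (\sum_(i < (size w).+1) u (take i w) * v (drop i w))%:E <=
  \esum_(x in [set: seq T]) \esum_(y in [set: seq T]) (u x * v y)%:E.
Proof.
move=> u0 v0.
have uv0 x y : 0 <= (u x * v y)%:E by rewrite lee_fin mulr_ge0.
pose J (w : seq T) : set nat := `I_(size w).+1.
under eq_esum => w _.
  rewrite -sumEFin.
  rewrite -(big_mkord xpredT (fun i => (u (take i w) * v (drop i w))%:E)) big_mkord.
  rewrite (fsbig_ord _ _ (fun i => (u (take i w) * v (drop i w))%:E)).
  rewrite -esum_fset; [|exact: finite_II|by move=> i _; exact: uv0].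
  over.
rewrite !esum_esum//.
pose e (z : seq T * nat) := (take z.2 z.1, drop z.2 z.1).
pose b (z : seq T * seq T) := (u z.1 * v z.2)%:E.
have einj : set_inj ([set: seq T] `*`` J) e.
  move=> [w i] [w' i'] /set_mem[/= _ wi] /set_mem[/= _ wi'] [ww' dd'].
  congr (_, _); first by rewrite -(cat_take_drop i w) ww' dd' cat_take_drop.
  by move/(congr1 size): ww'; rewrite !size_takel.
rewrite -(@esum_image _ _ _ _ e b einj) esum_mkcond [leRHS]esum_mkcond.
apply: le_esum => z _; rewrite (mem_set (_ : ([set: seq T] `*`` fun=> [set: seq T]) z))//.
by case: ifP => // _; exact: uv0.
Qed.

End EsumInterchange.

Section FreeEntireNorms.
Context {R : realType} {m : nat}.
Local Notation F := (freeEntire R m).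
Implicit Types (rho : {posnum R}) (a b : F) (w : seq 'I_m).

Lemma freeEntire0E w : val (0 : F) w = 0. Proof. by rewrite raddf0. Qed.

Lemma freeEntireDE a b w : val (a + b) w = val a w + val b w.
Proof. by rewrite raddfD. Qed.

Lemma freeEntireBE a b w : val (a - b) w = val a w - val b w.
Proof. by rewrite raddfB. Qed.

Lemma freeEntireZE k a w : val (k *: a) w = k * val a w.
Proof. by rewrite linearZ. Qed.

Lemma freeEntire_normE rho a :
  (freeEntire_norm rho a)%:E = wsum (fun w => rho%:num ^+ size w) (val a).
Proof. by rewrite fineK// freeEntire_norm_fin. Qed.

Lemma freeEntire_coef_le rho a w :
  normc (val a w) * rho%:num ^+ size w <= freeEntire_norm rho a.
Proof.
rewrite -lee_fin freeEntire_normE; apply: esum_ge; exists [set w].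
  by split.
by rewrite fsbig_set1.
Qed.

Lemma freeEntire_norm_le rho rho' a : rho%:num <= rho'%:num ->
  freeEntire_norm rho a <= freeEntire_norm rho' a.
Proof.
move=> rr; rewrite -lee_fin !freeEntire_normE; apply: le_esum => w _.
by rewrite lee_fin ler_wpM2l ?normc_ge0// lerXn2r ?nnegrE.
Qed.

Lemma freeEntire_normM rho a b : freeEntire_norm rho (a * b) <=
  freeEntire_norm rho a * freeEntire_norm rho b.
Proof.
rewrite -lee_fin EFinM !freeEntire_normE.
pose u (c : F) w := normc (val c w) * rho%:num ^+ size w.
have u0 c w : 0 <= u c w by rewrite mulr_ge0 ?normc_ge0 ?exprn_ge0.
apply: (@le_trans _ _ (\esum_(w in [set: seq 'I_m])
    (\sum_(i < (size w).+1) u a (take i w) * u b (drop i w))%:E)%E).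
  apply: le_esum => w _; rewrite lee_fin.
  apply: (@le_trans _ _ ((\sum_(i < (size w).+1)
      normc (val a (take i w) * val b (drop i w))) * rho%:num ^+ size w)).
    by rewrite ler_wpM2r ?exprn_ge0//; exact: normc_sum.
  rewrite mulr_suml; apply: ler_sum => i _.
  rewrite /u mulrACA -exprD size_takel -1?ltnS// size_drop subnKC -1?ltnS//.
  by rewrite Normc.normcM.
apply: (le_trans (esum_take_drop_le (u0 a) (u0 b))).
under eq_esum => x _.
  under eq_esum => y _ do rewrite EFinM.
  rewrite esumZl; [over|exact: u0|by move=> y; rewrite lee_fin].
rewrite le_eqVlt; apply/orP; left; apply/eqP.
rewrite -[X in (_ * X)%E]freeEntire_normE [RHS]muleC -esumZl//.
- by apply: eq_esum => x _; rewrite muleC; congr (_ * _)%E; exact/esym/freeEntire_normE.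
- exact: (seminorm_ge0 (freeEntire_norm_seminorm rho)).
- by move=> w; rewrite lee_fin; exact: u0.
Qed.

End FreeEntireNorms.

Section FreeEntireSeries.
Context {R : realType} {m : nat}.
Local Notation F := (freeEntire R m).

Definition nat_radius (n : nat) : {posnum R} := n.+1%:R%:pos.

(** Completeness of the free entire functions in the form used below: the
radius is allowed to grow with the index, so that the remainders are controlled
in every norm. *)
Lemma freeEntire_series (b : nat -> F) :
  (forall n, freeEntire_norm (nat_radius n) (b n) <= 2^-1 ^+ n.+1) ->
  exists a : F, forall n,
    freeEntire_norm (nat_radius n) (a - \sum_(k < n) b k) <= 2 * 2^-1 ^+ n.
Proof.
move=> bn.
pose W n (w : seq 'I_m) : R := (nat_radius n)%:num ^+ size w.
have W1 n w : 1 <= W n w by rewrite /W exprn_ege1//= ler1n.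
have half0 n : 0 <= 2^-1 ^+ n :> R by rewrite exprn_ge0.
pose coef w n : nat -> R[i] := fun k => val (b (n + k)%N) w.
have coefW n k w : normc (coef w n k) <= normc (coef w n k) * W (n + k)%N w.
  by rewrite ler_peMr ?normc_ge0.
have coefS w n : absolutely_summable (coef w n).
  apply: le_lt_trans (ltry (2^-1 ^+ n)); apply: le_trans (@esum_half_power R n).
  apply: le_esum => k _; rewrite lee_fin mulr1.
  apply: le_trans (coefW _ _ _) _; apply: le_trans (bn (n + k)%N).
  exact: freeEntire_coef_le.
(* T n is the remainder of the series after n terms. *)
pose T n : freeSeries R m := fun w => complex_sum (coef w n).
have TS n w : T n w = val (b n) w + T n.+1 w.
  rewrite /T complex_sum_recl// /coef addn0; congr (_ + complex_sum _).
  by apply/funext => k; rewrite addnS.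
have T0 n w : T 0%N w = val (\sum_(k < n) b k) w + T n w.
  elim: n => [|n IH]; first by rewrite big_ord0 freeEntire0E add0r.
  by rewrite IH TS big_ord_recr freeEntireDE addrA.
have TW n : (wsum (W n) (T n) <= (2 * 2^-1 ^+ n)%:E)%E.
  rewrite EFinM.
  apply: le_trans (lee_wpmul2l _ (@esum_half_power R n)); last by rewrite lee_fin.
  apply: (@le_trans _ _ (2%:E * \esum_(w in [set: seq 'I_m]) \esum_(k in [set: nat])
      (normc (coef w n k) * W n w)%:E)%E).
    rewrite -esumZl//; last first.
      move=> w; apply: esum_ge0 => k _.
      by rewrite lee_fin mulr_ge0 ?normc_ge0// (le_trans ler01).
    apply: le_esum => w _.
    have -> : (\esum_(k in [set: nat]) (normc (coef w n k) * W n w)%:E =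
        (W n w)%:E * wsum (fun=> 1%R) (coef w n))%E.
      rewrite /wsum -esumZl ?(le_trans ler01)//.
        by apply: eq_esum => k _; rewrite mulr1 -EFinM mulrC.
      by move=> k; rewrite lee_fin mulr1 normc_ge0.
    have Sfin : wsum (fun=> 1%R) (coef w n) \is a fin_num.
      by rewrite ge0_fin_numE; [exact: coefS|apply: wsum_ge0 => k; exact: ler01].
    rewrite -(fineK Sfin) -!EFinM lee_fin mulrCA mulrC.
    by rewrite ler_wpM2l ?complex_sum_le// (le_trans ler01).
  rewrite esum_interchange; last first.
    by move=> w k; rewrite lee_fin mulr_ge0 ?normc_ge0// (le_trans ler01).
  apply: lee_wpmul2l; first by rewrite lee_fin.
  apply: le_esum => k _.
  apply: (@le_trans _ _ (freeEntire_norm (nat_radius (n + k)) (b (n + k)%N))%:E).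
    rewrite freeEntire_normE; apply: le_esum => w _; rewrite lee_fin.
    by rewrite ler_wpM2l ?normc_ge0// lerXn2r ?nnegrE//= ler_nat ltnS leq_addr.
  by rewrite lee_fin.
have TF : free_entire (T 0%N).
  apply/asboolP => rho rho0.
  have [N rhoN] : exists N, rho <= N.+1%:R :> R.
    exists (Num.truncn rho); apply/ltW.
    by have /andP[] := truncn_itv (ltW rho0).
  have -> : T 0%N = fun w => val (\sum_(k < N) b k) w + T N w.
    by apply/funext => w; exact: T0.
  have rw0 (w : seq 'I_m) : 0 <= rho ^+ size w by rewrite exprn_ge0// ltW.
  apply: le_lt_trans (wsumD _ _ rw0) _; apply: lte_add_pinfty.
    by have /asboolP/(_ _ rho0) := valP (\sum_(k < N) b k).
  apply: le_lt_trans (ltry (2 * 2^-1 ^+ N)); apply: le_trans (TW N).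
  apply: le_esum => w _; rewrite lee_fin ler_wpM2l ?normc_ge0//.
  by rewrite lerXn2r ?nnegrE// ltW.
exists (exist _ (T 0%N) TF : F) => n; rewrite -lee_fin freeEntire_normE.
apply: le_trans (TW n); rewrite le_eqVlt; apply/orP; left; apply/eqP.
congr wsum; apply/funext => w.
have -> : T n w = T 0%N w - val (\sum_(k < n) b k) w by rewrite (T0 n) addrC addKr.
by rewrite freeEntireBE.
Qed.

End FreeEntireSeries.

(** * Quotients of free entire functions as locally convex algebras *)

Section QuotientSeminorms.
Context {R : realType} {m : nat} (I : twoSidedIdeal (freeEntire R m)).
Local Open Scope quotient_scope.
Local Notation F := (freeEntire R m).
Local Notation Q := (algQuotient I).
Implicit Types (rho : {posnum R}) (a b : F) (x y : Q).

Definition quotient_map a : Q := \pi_Q a.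
Local Notation pi := quotient_map.

Lemma quotient_map_surj x : exists a, pi a = x.
Proof. by exists (repr x); exact: reprK. Qed.

Lemma quotient_map_eq a b : (pi a = pi b) <-> (a - b \in I).
Proof. by split=> [/eqP|ab]; [|apply/eqP]; rewrite algQuotient_eq. Qed.

Lemma quotient_mapD a b : pi (a + b) = pi a + pi b.
Proof. exact: algQuotient_piD. Qed.

Lemma quotient_mapZ k a : pi (k *: a) = k *: pi a.
Proof. exact/esym/algQuotient_piZ. Qed.

Lemma quotient_mapM a b : pi (a * b) = pi a * pi b.
Proof. exact/esym/algQuotient_piM. Qed.

Lemma quotient_map0 : pi 0 = 0.
Proof. by rewrite -(scale0r 0) quotient_mapZ scale0r. Qed.

Lemma quotient_mapB a b : pi (a - b) = pi a - pi b.
Proof. by rewrite quotient_mapD -scaleN1r quotient_mapZ scaleN1r. Qed.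

Lemma quotient_map_eq0 a : (pi a = 0) <-> (a \in I).
Proof. by rewrite -quotient_map0 quotient_map_eq subr0. Qed.

Definition quotient_norm rho x : R :=
  inf [set freeEntire_norm rho a | a in [set a | pi a = x]].

Let norm_ge0 rho a : 0 <= freeEntire_norm rho a.
Proof. exact: (seminorm_ge0 (freeEntire_norm_seminorm rho)). Qed.

Let norm_inf rho x : has_inf [set freeEntire_norm rho a | a in [set a | pi a = x]].
Proof.
split; last by exists 0 => _ [a _ <-].
by have [a ax] := quotient_map_surj x; exists (freeEntire_norm rho a), a.
Qed.

Lemma quotient_norm_le rho a : quotient_norm rho (pi a) <= freeEntire_norm rho a.
Proof. by apply: ge_inf; [exact: (norm_inf rho (pi a)).2|exists a]. Qed.

Lemma quotient_norm_ge0 rho x : 0 <= quotient_norm rho x.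
Proof. by apply: lb_le_inf; [exact: (norm_inf rho x).1|move=> _ [a _ <-]]. Qed.

Lemma quotient_norm_lt rho x e : quotient_norm rho x < e ->
  exists2 a, pi a = x & freeEntire_norm rho a < e.
Proof. by move=> /(inf_lt (norm_inf rho x).1)[_ [a ax <-] ae]; exists a. Qed.

Lemma quotient_norm_seminorm rho : seminorm (quotient_norm rho).
Proof.
have FS := @freeEntire_norm_seminorm R m rho.
split=> [x y|k x].
  apply/ler_addgt0Pl => e e0; have e2 : 0 < e / 2 by rewrite divr_gt0.
  have [a <- ae] : exists2 a, pi a = x & freeEntire_norm rho a < quotient_norm rho x + e / 2.
    by apply: quotient_norm_lt; rewrite ltrDl.
  have [b <- be] : exists2 b, pi b = y & freeEntire_norm rho b < quotient_norm rho y + e / 2.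
    by apply: quotient_norm_lt; rewrite ltrDl.
  rewrite -quotient_mapD; apply: le_trans (quotient_norm_le _ _) _.
  apply: le_trans (seminormD FS a b) _; lra.
have le_scale (l : R[i]) y : l != 0 ->
    quotient_norm rho (l *: y) <= normc l * quotient_norm rho y.
  move=> l0; have nl0 : 0 < normc l.
    rewrite lt_neqAle normc_ge0 andbT eq_sym; apply: contra l0 => /eqP l0.
    by apply/eqP; exact: Normc.eq0_normc.
  rewrite mulrC -ler_pdivrMr//; apply/ler_addgt0Pl => e e0.
  have [a <- ae] : exists2 a, pi a = y & freeEntire_norm rho a < quotient_norm rho y + e.
    by apply: quotient_norm_lt; rewrite ltrDl.
  rewrite -quotient_mapZ ler_pdivrMr//; apply: le_trans (quotient_norm_le _ _) _.
  by rewrite seminormZ// mulrC ler_wpM2r ?normc_ge0// addrC ltW.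
have [->|k0] := eqVneq k 0.
  rewrite scale0r Normc.normc0 mul0r; apply/eqP; rewrite eq_le quotient_norm_ge0 andbT.
  rewrite -quotient_map0; apply: le_trans (quotient_norm_le _ _) _.
  by rewrite seminorm0.
apply/eqP; rewrite eq_le le_scale//=.
have := le_scale k^-1 (k *: x); rewrite invr_eq0 => /(_ k0).
rewrite scalerA mulVf// scale1r => h.
have nk : normc k * normc k^-1 = 1 by rewrite -Normc.normcM divff// Normc.normc1.
apply: le_trans (ler_wpM2l (normc_ge0 k) h) _.
by rewrite mulrA nk mul1r.
Qed.

Lemma quotient_normM rho x y :
  quotient_norm rho (x * y) <= quotient_norm rho x * quotient_norm rho y.
Proof.
set p := quotient_norm rho x; set q := quotient_norm rho y.
have p0 : 0 <= p := quotient_norm_ge0 rho x.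
have q0 : 0 <= q := quotient_norm_ge0 rho y.
apply/ler_addgt0Pl => e e0.
pose d := Num.min 1 (e / (p + q + 1)).
have pq1 : 0 < p + q + 1 by rewrite ltr_wpDl ?addr_ge0.
have d0 : 0 < d by rewrite lt_min ltr01 divr_gt0.
have [a ax ae] : exists2 a, pi a = x & freeEntire_norm rho a < p + d.
  by apply: quotient_norm_lt; rewrite ltrDl.
have [b bx be] : exists2 b, pi b = y & freeEntire_norm rho b < q + d.
  by apply: quotient_norm_lt; rewrite ltrDl.
rewrite -ax -bx -quotient_mapM; apply: le_trans (quotient_norm_le _ _) _.
apply: le_trans (freeEntire_normM _ _ _) _.
apply: (@le_trans _ _ ((p + d) * (q + d))).
  by apply: ler_pM => //; exact: ltW.
have d1 : d <= 1 by rewrite ge_min lexx.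
have de : d * (p + q + 1) <= e by rewrite -ler_pdivlMr// ge_min lexx orbT.
have : d * d <= d by rewrite ler_piMr// ltW.
rewrite mulrDl !mulrDr; lra.
Qed.

Lemma quotient_norm_mono rho rho' x : rho%:num <= rho'%:num ->
  quotient_norm rho x <= quotient_norm rho' x.
Proof.
move=> rr; apply/ler_addgt0Pl => e e0.
have [a <- ae] : exists2 a, pi a = x & freeEntire_norm rho' a < quotient_norm rho' x + e.
  by apply: quotient_norm_lt; rewrite ltrDl.
rewrite addrC; apply/ltW/(le_lt_trans (quotient_norm_le _ _)).
exact: le_lt_trans (freeEntire_norm_le _ rr) ae.
Qed.

Lemma posnum_bound (s : seq {posnum R}) :
  exists n, forall rho, rho \in s -> rho%:num <= (nat_radius n : {posnum R})%:num.
Proof.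
elim: s => [|rho s [n sn]]; first by exists 0%N.
exists (maxn n (Num.truncn rho%:num)) => rho'; rewrite inE => /predU1P[->|/sn le].
  apply: (@le_trans _ _ (Num.truncn rho%:num).+1%:R).
    by have /truncn_itv/andP[_ /ltW] : 0 <= rho%:num by [].
  by rewrite ler_nat ltnS leq_maxr.
by apply: (le_trans le); rewrite ler_nat ltnS leq_maxl.
Qed.

(** A quotient neighbourhood pulls back to one that contains a ball of a single
norm, because the norms increase with the radius. *)
Lemma quotient_norm_topology : generates_topology quotient_norm.
Proof.
move=> x; apply/seteqP; split=> U.
  rewrite nbhsE; case=> O [oO Ox] OU.
  have [a ax] := quotient_map_surj x.
  have : nbhs a (pi @^-1` O).
    apply: open_nbhs_nbhs; split; first exact: oO.
    by rewrite /preimage /= ax.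
  move=> [s [e [e0 sO]]].
  have [n sn] := posnum_bound s.
  exists [:: nat_radius n], e; split => // y.
  rewrite /seminorm_ball /= andbT => /quotient_norm_lt[b bxy be].
  have -> : y = pi (a + b) by rewrite quotient_mapD ax bxy addrC subrK.
  apply/OU/sO; rewrite /seminorm_ball /= addrC addKr.
  apply/allP => rho /sn h; exact: le_lt_trans (freeEntire_norm_le _ h) be.
move=> [s [e [e0 sU]]]; rewrite nbhsE; exists (seminorm_ball quotient_norm s e x).
  split; last exact: (seminorm_ball_center quotient_norm_seminorm).
  change (open (pi @^-1` seminorm_ball quotient_norm s e x)).
  rewrite openE => a ax; rewrite /interior.
  suff : \forall b \near a, all (fun rho => quotient_norm rho (pi b - x) < e) s by [].
  elim: s {sU} ax => [|rho s IH]; first by move=> _; exact: (@filterE _ (nbhs a)).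
  rewrite /preimage /seminorm_ball /= => /andP[iy sy].
  have h : 0 < e - quotient_norm rho (pi a - x) by rewrite subr_gt0.
  near=> b; apply/andP; split; last by near: b; exact: IH.
  have -> : pi b - x = (pi b - pi a) + (pi a - x) by rewrite addrA subrK.
  apply: le_lt_trans (seminormD (quotient_norm_seminorm rho) _ _) _.
  rewrite -ltrBrDr -quotient_mapB; apply: le_lt_trans (quotient_norm_le _ _) _.
  near: b; exact: (@near_seminorm _ _ _ freeEntire_norm).
exact: sU.
Unshelve. all: by end_near. Qed.

HB.instance Definition _ := PreTopologicalLmod_isTvs.Build R[i] Q
  (seminorm_add_continuous quotient_norm_seminorm quotient_norm_topology)
  (seminorm_scale_continuous quotient_norm_seminorm quotient_norm_topology)
  (seminorm_locally_convex quotient_norm_seminorm quotient_norm_topology).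

(* The previous instance supplies only the uniform structure. *)
HB.instance Definition _ := PreTopologicalNmodule_isTopologicalNmodule.Build Q
  (seminorm_add_continuous quotient_norm_seminorm quotient_norm_topology).

HB.instance Definition _ := TopologicalNmodule_isTopologicalLmodule.Build R[i] Q
  (seminorm_scale_continuous quotient_norm_seminorm quotient_norm_topology).

HB.instance Definition _ := Uniform_isTvs.Build R[i] Q
  (seminorm_locally_convex quotient_norm_seminorm quotient_norm_topology).

HB.instance Definition _ := hasContinuousMul.Build Q
  (seminorm_mul_continuous quotient_norm_seminorm quotient_norm_topology
    quotient_normM).

Definition quotient_algebra : lcAlgType R[i] := Q.

End QuotientSeminorms.

(** * Quotients by closed ideals are holomorphically finitely generated *)

Section QuotientHFG.
Context {R : realType} {m : nat} (I : twoSidedIdeal (freeEntire R m)).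
Local Notation F := (freeEntire R m).
Local Notation Q := (quotient_algebra I).
Local Notation pi := (quotient_map I).
Local Notation qnorm := (@quotient_norm R m I).

Let qS rho : seminorm (qnorm rho). Proof. exact: quotient_norm_seminorm. Qed.

Lemma quotient_norm_countable :
  generates_topology (fun n => qnorm (nat_radius n) : Q -> R).
Proof.
move=> x; rewrite quotient_norm_topology; apply/seteqP; split=> U.
  move=> [s [e [e0 sU]]]; have [n sn] := posnum_bound s.
  exists [:: n], e; split => // y; rewrite /seminorm_ball /= andbT => yx.
  apply: sU; apply/allP => rho /sn h; exact: le_lt_trans (quotient_norm_mono _ h) yx.
move=> [s [e [e0 sU]]]; exists (map (fun n => nat_radius n) s), e; split => // y.
by rewrite /seminorm_ball /= all_map => ys; exact: sU.
Qed.

(** A Cauchy filter is followed by a sequence whose consecutive differences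
are small in norms of growing radius; lifting the differences gives a
convergent series of free entire functions. *)
Lemma quotient_complete : complete_space Q.
Proof.
move=> G GF Gcauchy.
have half0 n : 0 < 2^-1 ^+ n :> R by rewrite exprn_gt0.
have small n : exists U : set Q, G U /\
    forall x y, U x -> U y -> qnorm (nat_radius n) (x - y) < 2^-1 ^+ n.+1.
  have := Gcauchy _ (near_seminorm (@quotient_norm_topology _ _ I) 0 (nat_radius n) (half0 n.+1)).
  move=> [[A B] /= [GA GB]] AB; exists (A `&` B); split; first exact: filterI.
  by move=> x y [Ax _] [_ By]; have := AB (x, y) (conj Ax By); rewrite /= subr0.
have [U US] := choice small.
(* x n lies in U 0, ..., U n, so that x n and x n.+1 are both in U n. *)
have [x xU] : exists x : nat -> Q, forall n k, (k <= n)%N -> U k (x n).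
  have : forall n, exists y, forall k, (k <= n)%N -> U k y.
    move=> n; suff GW : G (fun y => forall k, (k <= n)%N -> U k y).
      exact: (@filter_ex _ G).
    elim: n => [|n IH].
      apply: filterS (US 0%N).1 => y Uy k; rewrite leqn0 => /eqP->; exact: Uy.
    apply: filterS2 IH (US n.+1).1 => y Uy UnSy k.
    by rewrite leq_eqVlt => /predU1P[->//|]; exact: Uy.
  by move=> /choice[f fE]; exists f.
have [b bx] : exists b : nat -> F, forall n, pi (b n) = x n.+1 - x n /\
    freeEntire_norm (nat_radius n) (b n) <= 2^-1 ^+ n.+1.
  have : forall n, exists b : F, pi b = x n.+1 - x n /\
      freeEntire_norm (nat_radius n) b <= 2^-1 ^+ n.+1.
    move=> n; have xn : qnorm (nat_radius n) (x n.+1 - x n) < 2^-1 ^+ n.+1.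
      by apply: (US n).2; exact: xU.
    have [b bE bn] := quotient_norm_lt xn.
    by exists b; split=> //; exact: ltW.
  by move=> /choice[f fE]; exists f.
have [a an] := freeEntire_series (fun n => (bx n).2).
have sumb n : pi (\sum_(k < n) b k) = x n - x 0%N.
  elim: n => [|n IH]; first by rewrite big_ord0 quotient_map0 subrr.
  by rewrite big_ord_recr quotient_mapD IH (bx n).1 addrC addrA subrK.
exists (pi a + x 0%N).
have xlim n : qnorm (nat_radius n) (pi a + x 0%N - x n) <= 2 * 2^-1 ^+ n.
  rewrite -addrA -[x 0%N - _]opprB -sumb -quotient_mapB.
  exact: le_trans (quotient_norm_le _ _ _) (an n).
apply: (cvg_seminorm (@quotient_norm_topology _ _ I) (f := id)) => rho e e0.
have [N rhoN] := posnum_bound [:: rho].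
have [n [Nn ne]] : exists n, (N <= n)%N /\ 3 * 2^-1 ^+ n < e.
  have e3 : 0 <= 3 / e by rewrite divr_ge0// ltW.
  exists (N + (Num.truncn (3 / e)).+1)%N; split; first exact: leq_addr.
  rewrite exprVn ltr_pdivrMr ?exprn_gt0// mulrC -ltr_pdivrMr//.
  have /andP[_ /lt_trans] := truncn_itv e3; apply.
  by rewrite -natrX ltr_nat (leq_ltn_trans (leq_addl N _))// ltn_expl.
apply: filterS (US n).1 => y Uy.
have -> : y - (pi a + x 0%N) = (y - x n) - (pi a + x 0%N - x n).
  by rewrite opprB addrA subrK.
have le_n z : qnorm rho z <= qnorm (nat_radius n) z.
  apply: quotient_norm_mono; apply: (@le_trans _ _ (nat_radius N)%:num).
    by apply: rhoN; rewrite inE.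
  by rewrite ler_nat ltnS.
apply: le_lt_trans (le_n _) _; apply: le_lt_trans ne.
apply: le_trans (seminormD (qS _) _ _) _; rewrite seminormN//.
have yn : qnorm (nat_radius n) (y - x n) < 2^-1 ^+ n.+1 by apply: (US n).2 => //; exact: xU.
have := xlim n; have := half0 n; move: yn; rewrite exprS; lra.
Qed.

Hypothesis Iclosed : closed [set` I].

(** Closedness of the ideal enters here: an element of norm zero in the
quotient has a representative in the closure of the ideal. *)
Lemma quotient_norm_separates (x : Q) : (forall rho, qnorm rho x = 0) -> x = 0.
Proof.
have [a <-] := quotient_map_surj x => a0; apply/quotient_map_eq0.
apply: Iclosed => U [s [e [e0 sU]]].
have [n sn] := posnum_bound s.
have : qnorm (nat_radius n) (pi a) < e by rewrite a0.
move=> /quotient_norm_lt[b /quotient_map_eq bI be].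
exists (a - b); split; first by rewrite /= -opprB rpredN.
apply: sU; apply/allP => rho /sn h.
rewrite addrC addrA addNr sub0r (seminormN (freeEntire_norm_seminorm rho)).
exact: le_lt_trans (freeEntire_norm_le _ h) be.
Qed.

Lemma quotient_hfg : hfg Q.
Proof.
have QT : hausdorff_space Q.
  exact: (seminorm_hausdorff qS (@quotient_norm_topology _ _ I)
    quotient_norm_separates).
split.
- split=> //; first exact: quotient_complete.
  by exists (fun n => qnorm (nat_radius n)); split; [|exact: quotient_norm_countable].
- split=> //; first exact: quotient_complete.
  exists {posnum R}, qnorm; split=> //; last exact: quotient_norm_topology.
  by move=> rho x y; exact: quotient_normM.
- by exists m, I; split=> //; exists idfun, idfun; split=> // x; exact: cvg_id.
Qed.

End QuotientHFG.

(** * Bounded functionals and density of words *)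

Lemma esum_adherent {R : realType} (T : choiceType) (t : T -> \bar R) (e : R) :
  0 < e -> (\esum_(x in [set: T]) t x \is a fin_num)%E ->
  exists2 X : set T, finite_set X &
    (\esum_(x in [set: T]) t x - e%:E < \sum_(x \in X) t x)%E.
Proof.
rewrite /esum => e0 tfin.
have [_ [X [finX _] <-]] := ub_ereal_sup_adherent e0 tfin.
by exists X.
Qed.

Section BoundedFunctionals.
Context {R : realType} {m : nat}.
Local Notation F := (freeEntire R m).
Implicit Types (a b f u v : F) (w : seq 'I_m) (phi : F -> R[i]).

Lemma monomial_entire w : free_entire (fun w' => (w' == w)%:R : R[i]).
Proof.
apply/asboolP => rho rho0; apply: (wsum_point (t := w)) => [w'|w' /negPf->//].
by rewrite exprn_ge0// ltW.
Qed.

Definition monomial w : F :=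
  exist _ ((fun w' => (w' == w)%:R) : freeSeries R m) (monomial_entire w).

Lemma monomialE w w' : val (monomial w) w' = (w' == w)%:R. Proof. by []. Qed.

Lemma monomial_nil : monomial [::] = 1.
Proof. exact: val_inj. Qed.

Lemma monomialM w w' : monomial w * monomial w' = monomial (w ++ w').
Proof.
apply: val_inj; apply/funext => z.
transitivity (\sum_(i < (size z).+1)
    (take i z == w)%:R * (drop i z == w')%:R : R[i]) => //.
rewrite monomialE; have [->|zww'] := eqVneq z (w ++ w').
  have wz : (size w < (size (w ++ w')).+1)%N by rewrite ltnS size_cat leq_addr.
  rewrite (bigD1 (Ordinal wz))//= take_size_cat// drop_size_cat// !eqxx mulr1.
  rewrite big1 ?addr0// => i /eqP iw; case: eqP => [tw|]; last by rewrite mul0r.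
  case: iw; apply: val_inj => /=; move/(congr1 size): tw.
  by rewrite size_takel// -ltnS; exact: ltn_ord.
apply: big1 => i _; case: eqP => [tw|]; last by rewrite mul0r.
case: eqP => [dw|]; last by rewrite mulr0.
by move: zww'; rewrite -tw -dw cat_take_drop eqxx.
Qed.

Definition bounded_functional phi :=
  (forall k a b, phi (k *: a + b) = k * phi a + phi b) /\
  exists rho C, forall f, normc (phi f) <= C * freeEntire_norm rho f.

Lemma freeEntire_topology :
  generates_topology (freeEntire_norm : {posnum R} -> F -> R).
Proof. by []. Qed.

Lemma freeEntire_norm_ge0 rho f : 0 <= freeEntire_norm rho f.
Proof. exact: (seminorm_ge0 (freeEntire_norm_seminorm rho)). Qed.

Lemma bounded_functional0 phi : bounded_functional phi -> phi 0 = 0.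
Proof. by move=> [lin _]; have := lin (-1) 0 0; rewrite scaler0 addr0 mulN1r addNr. Qed.

Lemma bounded_functionalD phi psi : bounded_functional phi ->
  bounded_functional psi -> bounded_functional (fun f => phi f + psi f).
Proof.
move=> [lin1 [r1 [C1 b1]]] [lin2 [r2 [C2 b2]]]; split.
  by move=> k a b; rewrite lin1 lin2 mulrDr addrACA.
have [n rn] := posnum_bound [:: r1; r2].
exists (nat_radius n), (`|C1| + `|C2|) => f; rewrite mulrDl.
apply: le_trans (normcD _ _) _; apply: lerD.
  apply: le_trans (b1 f) _; apply: (@le_trans _ _ (`|C1| * freeEntire_norm r1 f)).
    by rewrite ler_wpM2r ?freeEntire_norm_ge0 ?ler_norm.
  by rewrite ler_wpM2l// freeEntire_norm_le// rn// inE eqxx.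
apply: le_trans (b2 f) _; apply: (@le_trans _ _ (`|C2| * freeEntire_norm r2 f)).
  by rewrite ler_wpM2r ?freeEntire_norm_ge0 ?ler_norm.
by rewrite ler_wpM2l// freeEntire_norm_le// rn// !inE eqxx orbT.
Qed.

Lemma bounded_functionalZ (c : R[i]) phi : bounded_functional phi ->
  bounded_functional (fun f => phi f * c).
Proof.
move=> [lin [r [C b]]]; split=> [k x y|]; first by rewrite lin mulrDl mulrA.
exists r, (normc c * C) => f; rewrite Normc.normcM mulrC -mulrA.
by rewrite ler_wpM2l ?normc_ge0.
Qed.

Lemma bounded_functional_sum n (phi : 'I_n -> F -> R[i]) :
  (forall i, bounded_functional (phi i)) ->
  bounded_functional (fun f => \sum_(i < n) phi i f).
Proof.
elim: n phi => [|n IH] phi bphi.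
  have -> : (fun f => \sum_(i < 0) phi i f) = fun=> 0.
    by apply/funext => f; rewrite big_ord0.
  split=> [k a b|]; first by rewrite mulr0 addr0.
  by exists 1%:pos, 0 => f; rewrite Normc.normc0 mul0r.
have -> : (fun f => \sum_(i < n.+1) phi i f) =
    fun f => \sum_(i < n) phi (widen_ord (leqnSn n) i) f + phi ord_max f.
  by apply/funext => f; rewrite big_ord_recr.
by apply: bounded_functionalD => //; exact: IH.
Qed.

Lemma bounded_functional_mul phi u v : bounded_functional phi ->
  bounded_functional (fun f => phi (u * f * v)).
Proof.
move=> [lin [r [C b]]]; split=> [k x y|].
  by rewrite -lin mulrDr mulrDl -scalerAr -scalerAl.
exists r, (`|C| * freeEntire_norm r u * freeEntire_norm r v) => f.
apply: le_trans (b _) _.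
apply: (@le_trans _ _ (`|C| * freeEntire_norm r (u * f * v))).
  by rewrite ler_wpM2r ?freeEntire_norm_ge0 ?ler_norm.
rewrite -!mulrA ler_wpM2l//; apply: le_trans (freeEntire_normM _ _ _) _.
by rewrite ler_wpM2l ?freeEntire_norm_ge0// [leRHS]mulrC freeEntire_normM.
Qed.

Lemma monomial_sumE f (s : seq (seq 'I_m)) w : uniq s ->
  val (\sum_(w' <- s) val f w' *: monomial w') w = if w \in s then val f w else 0.
Proof.
elim: s => [_|w' s IH]; first by rewrite big_nil freeEntire0E.
rewrite cons_uniq => /andP[w's us].
rewrite big_cons freeEntireDE freeEntireZE monomialE IH// inE.
have [->|ww'] := eqVneq w w'; first by rewrite (negPf w's) mulr1 addr0.
by rewrite mulr0 add0r.
Qed.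

Lemma wsum_complement (W : seq 'I_m -> R) (a b : seq 'I_m -> R[i])
    (X : set (seq 'I_m)) : (forall w, 0 <= W w) ->
  (forall w, b w = if w \in X then 0 else a w) ->
  wsum W a = (\esum_(w in X) (normc (a w) * W w)%:E + wsum W b)%E.
Proof.
move=> W0 bE; rewrite {1}/wsum (esumID X)//; last first.
  by move=> w _; rewrite lee_fin mulr_ge0 ?normc_ge0.
rewrite !setTI; congr (_ + _)%E.
rewrite [LHS]esum_mkcond; apply: eq_esum => w _; rewrite bE in_setC.
by case: (w \in X); rewrite ?Normc.normc0 ?mul0r.
Qed.

Lemma freeEntire_tail f rho e : 0 < e -> exists s : seq (seq 'I_m),
  freeEntire_norm rho (f - \sum_(w <- s) val f w *: monomial w) < e.
Proof.
move=> e0; pose W (w : seq 'I_m) : R := rho%:num ^+ size w.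
have W0 w : 0 <= W w by rewrite exprn_ge0.
have W0' (X : set (seq 'I_m)) : (0 <= \esum_(w in X) (normc (val f w) * W w)%:E)%E.
  by apply: esum_ge0 => w _; rewrite lee_fin mulr_ge0 ?normc_ge0.
have total : wsum W (val f) = (freeEntire_norm rho f)%:E by rewrite freeEntire_normE.
have totalfin : wsum W (val f) \is a fin_num by rewrite total.
have [X finX] := esum_adherent e0 totalfin.
rewrite -esum_fset//; last by move=> w _; rewrite lee_fin mulr_ge0 ?normc_ge0.
move=> Xe; have [s sX] := (finite_seqP X).1 finX; exists (undup s).
set g := f - _.
have gE w : val g w = if w \in X then 0 else val f w.
  rewrite freeEntireBE monomial_sumE ?undup_uniq// mem_undup sX mem_setE.
  by case: ifP; rewrite ?subrr ?subr0.
move: Xe; rewrite -/(wsum W (val f)) (wsum_complement W0 gE) -[wsum W (val g)]freeEntire_normE.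
have Xfin : (\esum_(w in X) (normc (val f w) * W w)%:E)%E \is a fin_num.
  rewrite ge0_fin_numE//; apply: le_lt_trans (ltry (freeEntire_norm rho f)).
  by rewrite -total (wsum_complement W0 gE) leeDl// wsum_ge0.
rewrite -(fineK Xfin) -EFinD lte_fin.
by rewrite ltrBlDr ltrD2l.
Qed.

(** Finite combinations of the words in the support of [f] approximate [f]. *)
Lemma bounded_functional_eq0 phi f : bounded_functional phi ->
  (forall w, val f w != 0 -> phi (monomial w) = 0) -> phi f = 0.
Proof.
move=> bphi phi0; have [lin [rho [C bC]]] := bphi.
have phi_sum (s : seq (seq 'I_m)) : phi (\sum_(w <- s) val f w *: monomial w) = 0.
  elim: s => [|w s IH]; first by rewrite big_nil bounded_functional0.
  rewrite big_cons lin IH addr0; have [->|fw] := eqVneq (val f w) 0.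
    by rewrite mul0r.
  by rewrite phi0// mulr0.
apply: Normc.eq0_normc; apply/eqP; rewrite eq_le normc_ge0 andbT.
apply/ler_addgt0Pl => e e0; rewrite addr0.
have C1 : 0 < `|C| + 1 by rewrite ltr_wpDl.
have [s se] := freeEntire_tail f rho (divr_gt0 e0 C1).
have -> : phi f = phi (f - \sum_(w <- s) val f w *: monomial w).
  by rewrite addrC -scaleN1r lin phi_sum mulr0 add0r.
apply: le_trans (bC _) _.
move: se; rewrite ltr_pdivlMr// => /ltW; apply: le_trans.
rewrite mulrC ler_wpM2l ?freeEntire_norm_ge0//.
by apply: le_trans (ler_norm _) _; rewrite lerDl.
Qed.

Lemma closed_kernel phi : bounded_functional phi -> closed [set f | phi f = 0].
Proof.
move=> bphi f fcl /=; have [lin [rho [C bC]]] := bphi.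
apply: Normc.eq0_normc; apply/eqP; rewrite eq_le normc_ge0 andbT.
apply/ler_addgt0Pl => e e0; rewrite addr0.
have C1 : 0 < `|C| + 1 by rewrite ltr_wpDl.
have [g [/= g0 ge]] := fcl _ (near_seminorm freeEntire_topology f rho (divr_gt0 e0 C1)).
have := lin (-1) f g; rewrite g0 addr0 mulN1r scaleN1r [- f + g]addrC => phigf.
rewrite -[phi f]opprK -phigf normcN; apply: le_trans (bC _) _.
move: ge; rewrite ltr_pdivlMr// => /ltW; apply: le_trans.
rewrite mulrC ler_wpM2l ?freeEntire_norm_ge0//.
by apply: le_trans (ler_norm _) _; rewrite lerDl.
Qed.

Lemma weighted_sum_functional (c : seq 'I_m -> R[i]) (rho : {posnum R}) (C : R) :
  (forall w, normc (c w) <= C * rho%:num ^+ size w) ->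
  bounded_functional (fun f => complex_sum (fun w => val f w * c w)).
Proof.
move=> cC.
have sumle f : (wsum (fun=> 1%R) (fun w => val f w * c w)%R <=
    (C * freeEntire_norm rho f)%:E)%E.
  have C0 : 0 <= C by have := cC [::]; rewrite expr0 mulr1; apply: le_trans (normc_ge0 _).
  rewrite EFinM freeEntire_normE -esumZl//; last first.
    by move=> w; rewrite lee_fin mulr_ge0 ?normc_ge0.
  apply: le_esum => w _; rewrite mulr1 -EFinM lee_fin Normc.normcM mulrCA.
  by rewrite ler_wpM2l ?normc_ge0.
have fS f : absolutely_summable (fun w => val f w * c w).
  by apply: le_lt_trans (sumle f) _; rewrite ltry.
split=> [k a b|].
  rewrite -complex_sumZ// -complex_sumD//; last exact: absolutely_summableZ.
  congr complex_sum; apply/funext => w.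
  by rewrite freeEntireDE freeEntireZE mulrDl mulrA.
exists rho, (2 * C) => f; apply: le_trans (complex_sum_le (fS f)) _.
rewrite -mulrA ler_wpM2l// -lee_fin fineK//.
by rewrite ge0_fin_numE; [exact: fS|apply: wsum_ge0 => w; exact: ler01].
Qed.

End BoundedFunctionals.

(** * Block words and the symbol map *)

Section Words.
Context {R : realType} (gamma : nat -> nat -> R).
Local Notation word := (seq 'I_4).

Definition opening : 'I_4 := @Ordinal 4 0 isT.
Definition degree_letter : 'I_4 := @Ordinal 4 1 isT.
Definition weight_letter : 'I_4 := @Ordinal 4 2 isT.
Definition closing : 'I_4 := @Ordinal 4 3 isT.

(** A deterministic automaton: the state is [None] between blocks and
[Some (n, k)] inside a block in which [n] degree letters and [k] weight letters
have been read. *)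
Fixpoint word_value (q : option (nat * nat)) (w : word) {struct w} : R :=
  match w, q with
  | [::], None => 1
  | [::], Some _ => 0
  | x :: w', None =>
      if x == opening then word_value (Some (0%N, 0%N)) w' else 0
  | x :: w', Some (n, k) =>
      if x == degree_letter then word_value (Some (n.+1, k)) w'
      else if x == weight_letter then word_value (Some (n, k.+1)) w'
      else if x == closing then gamma n k * word_value None w'
      else 0
  end.

Definition word_degree (w : word) : nat := count_mem degree_letter w.

Definition block n k : word :=
  opening :: nseq n degree_letter ++ nseq k weight_letter ++ [:: closing].

Lemma word_degree_cat u v : word_degree (u ++ v) = (word_degree u + word_degree v)%N.
Proof. exact: count_cat. Qed.

Lemma word_degree_block n k : word_degree (block n k) = n.
Proof.
by rewrite /word_degree /block /= !count_cat !count_nseq /= mul1n mul0n !addn0.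
Qed.

Lemma size_block n k : size (block n k) = (n + k).+2.
Proof. by rewrite /block /= !size_cat !size_nseq /= addn1 addnS. Qed.

Lemma word_value_degree_letters p n k z :
  word_value (Some (p, k)) (nseq n degree_letter ++ z) = word_value (Some (p + n, k)%N) z.
Proof. by elim: n p => [|n IH] p /=; rewrite ?addn0// IH addnS. Qed.

Lemma word_value_weight_letters n p k z :
  word_value (Some (n, p)) (nseq k weight_letter ++ z) = word_value (Some (n, p + k)%N) z.
Proof. by elim: k p => [|k IH] p /=; rewrite ?addn0// IH addnS. Qed.

Lemma word_value_block n k v :
  word_value None (block n k ++ v) = gamma n k * word_value None v.
Proof.
rewrite /block /= -!catA word_value_degree_letters word_value_weight_letters.
by rewrite add0n.
Qed.

(** An opening letter is only accepted between blocks, so the automaton must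
be in state [None] after reading [u]. *)
Lemma word_value_opening q u z :
  word_value q (u ++ opening :: z) = word_value q u * word_value None (opening :: z).
Proof.
elim: u q => [|x u IH] [[n k]|] /=; rewrite ?mul0r ?mul1r//.
  by do 3 (case: ifP => _; first by rewrite IH// mulrA); rewrite mul0r.
by case: ifP => _; rewrite ?IH ?mul0r.
Qed.

Lemma word_value_insert u n k v :
  word_value None (u ++ block n k ++ v) =
  gamma n k * (word_value None u * word_value None v).
Proof. by rewrite word_value_opening word_value_block mulrCA. Qed.

Hypothesis gamma_gt0 : forall n k, 0 < gamma n k.

Lemma word_value_ge0 q w : 0 <= word_value q w.
Proof.
elim: w q => [|x w IH] [[n k]|]//=; last by case: ifP.
by do 3 (case: ifP => _ //); rewrite mulr_ge0// ltW.
Qed.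

End Words.

(** Values of the blocks together with the weights of the seminorms on power
series for which the symbol is continuous. The weights may vanish, as for the
seminorms of the product topology. *)
Record blockSystem (R : realType) := BlockSystem {
  bs_index : Type;
  bs_weight : bs_index -> nat -> R;
  bs_gamma : nat -> nat -> R;
  bs_weight_ge0 : forall i n, 0 <= bs_weight i n;
  bs_weight_gt0 : forall n, exists i, 0 < bs_weight i n;
  bs_gamma_gt0 : forall n k, 0 < bs_gamma n k;
  bs_bound : forall i, exists rho : {posnum R}, forall w,
    word_value bs_gamma None w * bs_weight i (word_degree w) <= rho%:num ^+ size w
}.

Section Symbol.
Context {R : realType} (D : blockSystem R).
Local Notation F := (freeEntire R 4).
Local Notation word := (seq 'I_4).
Local Notation gamma := (bs_gamma D).
Local Notation W := (@bs_weight R D).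
Implicit Types (f u v : F) (w : word).

Definition symbol_coef (n : nat) w : R :=
  if word_degree w == n then word_value gamma None w else 0.

Definition symbol f : powser R :=
  fun n => complex_sum (fun w => val f w * (symbol_coef n w)%:C%C).

Lemma symbol_coef_ge0 n w : 0 <= symbol_coef n w.
Proof. by rewrite /symbol_coef; case: ifP => // _; exact/word_value_ge0/bs_gamma_gt0. Qed.

Lemma normc_real (x : R) : 0 <= x -> normc x%:C%C = x.
Proof. by move=> x0; rewrite /= expr0n /= addr0 sqrtr_sqr ger0_norm. Qed.

Lemma symbol_functional n : bounded_functional (fun f => symbol f n).
Proof.
have [i Wi] := bs_weight_gt0 D n; have [rho gW] := bs_bound i.
apply: (@weighted_sum_functional _ _ _ rho (W i n)^-1) => w.
rewrite normc_real ?symbol_coef_ge0// mulrC ler_pdivlMr//.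
rewrite /symbol_coef; case: eqP => [<-|_]; first exact: gW.
by rewrite mul0r exprn_ge0.
Qed.

(** The degree of a word is a single number, so exchanging the sums over
degrees and words leaves the weight [bs_weight i (word_degree w)] on [w]. *)
Lemma symbol_bound i : exists rho : {posnum R}, forall f,
  (wsum (W i) (symbol f) <= (2 * freeEntire_norm rho f)%:E)%E.
Proof.
have [rho gW] := bs_bound i; exists rho => f.
have gW0 n w : 0 <= normc (val f w) * symbol_coef n w * W i n.
  by rewrite !mulr_ge0 ?normc_ge0 ?symbol_coef_ge0 ?bs_weight_ge0.
apply: (@le_trans _ _ (2%:E * \esum_(n in [set: nat]) \esum_(w in [set: word])
    (normc (val f w) * symbol_coef n w * W i n)%:E)%E); last first.
  rewrite EFinM; apply: lee_wpmul2l; first by rewrite lee_fin.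
  rewrite esum_interchange; last by move=> n w; rewrite lee_fin.
  rewrite freeEntire_normE; apply: le_esum => w _.
  rewrite (@Esum_point _ _ _ (word_degree w))//; last first.
    by move=> n; rewrite /symbol_coef eq_sym => /negPf->; rewrite mulr0 mul0r.
  by rewrite /symbol_coef eqxx lee_fin -mulrA ler_wpM2l ?normc_ge0.
rewrite -esumZl//; last first.
  by move=> n; apply: esum_ge0 => w _; rewrite lee_fin.
apply: le_esum => n _.
have [->|Wn] := eqVneq (W i n) 0.
  by rewrite mulr0 mule_ge0// esum_ge0// => w _; rewrite mulr0.
have Wn0 : 0 < W i n by rewrite lt_neqAle eq_sym Wn bs_weight_ge0.
set a := fun w => val f w * (symbol_coef n w)%:C%C.
have -> : (\esum_(w in [set: word]) (normc (val f w) * symbol_coef n w * W i n)%:E =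
    (W i n)%:E * wsum (fun=> 1%R) a)%E.
  rewrite /wsum -esumZl ?bs_weight_ge0//; last first.
    by move=> w; rewrite lee_fin mulr1 normc_ge0.
  apply: eq_esum => w _; rewrite -EFinM mulr1 Normc.normcM normc_real ?symbol_coef_ge0//.
  by rewrite mulrC.
have aS : absolutely_summable a.
  apply: (@le_lt_trans _ _ ((W i n)^-1 * freeEntire_norm rho f)%:E); last by rewrite ltry.
  rewrite EFinM freeEntire_normE -esumZl ?invr_ge0 ?bs_weight_ge0//; last first.
    by move=> w; rewrite lee_fin mulr_ge0 ?normc_ge0 ?exprn_ge0.
  apply: le_esum => w _; rewrite -EFinM lee_fin mulr1 Normc.normcM mulrCA.
  rewrite normc_real ?symbol_coef_ge0// ler_wpM2l ?normc_ge0// mulrC ler_pdivlMr//.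
  rewrite /symbol_coef; case: eqP => [<-|_]; first exact: gW.
  by rewrite mul0r exprn_ge0.
have afin : wsum (fun=> 1%R) a \is a fin_num.
  by rewrite ge0_fin_numE; [exact: aS|apply: wsum_ge0 => w; exact: ler01].
rewrite -(fineK afin) -!EFinM lee_fin mulrCA mulrC ler_wpM2l ?bs_weight_ge0//.
exact: complex_sum_le.
Qed.

Lemma symbol_linear k f g : symbol (k *: f + g) = k *: symbol f + symbol g.
Proof. by apply/funext => n; have [lin _] := symbol_functional n; exact: lin. Qed.

Lemma symbolD f g : symbol (f + g) = symbol f + symbol g.
Proof. by have := symbol_linear 1 f g; rewrite !scale1r. Qed.

Lemma symbol0 : symbol 0 = 0.
Proof. by apply: (@addrI _ (symbol 0)); rewrite -symbolD !addr0. Qed.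

Lemma symbolZ k f : symbol (k *: f) = k *: symbol f.
Proof. by have := symbol_linear k f 0; rewrite symbol0 !addr0. Qed.

Lemma symbolB f g : symbol (f - g) = symbol f - symbol g.
Proof. by rewrite symbolD -[- g]scaleN1r symbolZ scaleN1r. Qed.

Definition powser_monomial (n : nat) : powser R := fun j => (j == n)%:R.

Lemma powser_monomialM n p :
  powser_monomial n * powser_monomial p = powser_monomial (n + p).
Proof.
apply/funext => j; transitivity (\sum_(i < j.+1) (nat_of_ord i == n)%:R * (j - i == p)%N%:R : R[i]) => //.
rewrite /powser_monomial; have [->|jnp] := eqVneq j (n + p)%N.
  have nlt : (n < (n + p).+1)%N by rewrite ltnS leq_addr.
  rewrite (bigD1 (Ordinal nlt))//= addKn !eqxx mulr1 big1 ?addr0// => i /eqP ine.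
  case: eqP => [iE|]; last by rewrite mul0r.
  by case: ine; exact: val_inj.
apply: big1 => i _; case: eqP => [iE|]; last by rewrite mul0r.
case: eqP => [jE|]; last by rewrite mulr0.
by move: jnp; rewrite -iE -jE subnKC ?eqxx// -ltnS.
Qed.

Lemma symbol_monomial w :
  symbol (monomial w) = (word_value gamma None w)%:C%C *: powser_monomial (word_degree w).
Proof.
apply/funext => n; rewrite /symbol (complex_sum_point (t0 := w)); last first.
  by move=> t /negPf tw; rewrite monomialE tw mul0r.
rewrite monomialE eqxx mul1r /symbol_coef.
transitivity ((word_value gamma None w)%:C%C * (n == word_degree w)%:R) => //.
by rewrite eq_sym; case: eqP; rewrite ?mulr1 ?mulr0.
Qed.

Lemma symbol1 : symbol 1 = 1.
Proof. by rewrite -monomial_nil symbol_monomial /= scale1r. Qed.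

(** The delimiters make the block visible in every context: the identity holds
for arbitrary words [u] and [v], parts of blocks included. *)
Lemma symbol_insert (u v : word) n k :
  symbol (monomial u * monomial (block n k) * monomial v) =
  symbol (monomial u) * symbol (monomial (block n k)) * symbol (monomial v).
Proof.
rewrite !monomialM -catA !symbol_monomial.
do 3 rewrite -?scalerAl -?scalerAr; rewrite !scalerA !powser_monomialM.
rewrite !word_degree_cat addnA word_value_insert; congr (_ *: _).
rewrite -[block n k in RHS]cats0 word_value_block /= mulr1 -!rmorphM.
by rewrite mulrC.
Qed.

End Symbol.

(** * The ideal and the subalgebra defined by the symbol *)

Section BoundedOperators.
Context {R : realType} {m : nat}.
Local Notation F := (freeEntire R m).
Implicit Types (f u v : F) (Phi Psi : F -> powser R).

Definition bounded_operator Phi :=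
  forall n, bounded_functional (fun f => Phi f n).

Lemma bounded_operatorD Phi Psi : bounded_operator Phi -> bounded_operator Psi ->
  bounded_operator (fun f => Phi f + Psi f).
Proof. by move=> bPhi bPsi n; exact: bounded_functionalD. Qed.

Lemma bounded_operator_scale phi (X : powser R) : bounded_functional phi ->
  bounded_operator (fun f => phi f *: X).
Proof. by move=> bphi n; exact: bounded_functionalZ. Qed.

Lemma bounded_operator_mulr Phi (X : powser R) : bounded_operator Phi ->
  bounded_operator (fun f => Phi f * X).
Proof.
move=> bPhi n.
by apply: bounded_functional_sum => i; exact: bounded_functionalZ.
Qed.

Lemma bounded_operator_mull Phi (X : powser R) : bounded_operator Phi ->
  bounded_operator (fun f => X * Phi f).
Proof.
move=> bPhi n.
have -> : (fun f => (X * Phi f) n) =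
    fun f => \sum_(i < n.+1) Phi f (n - i)%N * X i.
  by apply/funext => f; apply: eq_bigr => i _; rewrite mulrC.
by apply: bounded_functional_sum => i; exact: bounded_functionalZ.
Qed.

Lemma bounded_operator_insert Phi u v : bounded_operator Phi ->
  bounded_operator (fun f => Phi (u * f * v)).
Proof. by move=> bPhi n; exact: (bounded_functional_mul u v (bPhi n)). Qed.

Lemma bounded_operator_eq Phi Psi f : bounded_operator Phi -> bounded_operator Psi ->
  (forall w, val f w != 0 -> Phi (monomial w) = Psi (monomial w)) ->
  Phi f = Psi f.
Proof.
move=> bPhi bPsi PhiPsi; apply/funext => n; apply/eqP; rewrite -subr_eq0 -mulrN1.
apply/eqP; apply: (bounded_functional_eq0
  (phi := fun f => Phi f n + Psi f n * (-1))) => [|w fw].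
  by apply: bounded_functionalD => //; exact: bounded_functionalZ.
by rewrite PhiPsi// mulrN1 subrr.
Qed.

Lemma closed_equalizer Phi Psi : bounded_operator Phi -> bounded_operator Psi ->
  closed [set f | Phi f = Psi f].
Proof.
move=> bPhi bPsi.
have -> : [set f | Phi f = Psi f] =
    \bigcap_(n in [set: nat]) [set f | Phi f n + Psi f n * (-1) = 0].
  apply/seteqP; split=> f /=.
    by move=> PhiPsi n _ /=; rewrite PhiPsi mulrN1 subrr.
  move=> PhiPsi; apply/funext => n; apply/eqP; rewrite -subr_eq0 -mulrN1.
  by apply/eqP; exact: PhiPsi.
apply: closed_bigI => n _; apply: closed_kernel.
by apply: bounded_functionalD => //; exact: bounded_functionalZ.
Qed.

End BoundedOperators.

Section SymbolAlgebra.
Context {R : realType} (D : blockSystem R).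
Local Notation F := (freeEntire R 4).
Local Notation word := (seq 'I_4).
Local Notation gamma := (bs_gamma D).
Local Notation W := (@bs_weight R D).
Local Notation symbol := (symbol D).
Implicit Types (f g u v : F) (w : word).

Lemma symbol_operator : bounded_operator symbol.
Proof. by move=> n; exact: symbol_functional. Qed.

(** The largest two-sided ideal on which the symbol vanishes. *)
Definition null f := forall u v, symbol (u * f * v) = 0.

(** The value that the symbol of [u * f * v] takes when [f] acts as a power
series in y: the constant term of [f] acts as a scalar, the remaining terms are
combinations of blocks and separate [u] from [v]. *)
Definition factorized f u v : powser R :=
  symbol f 0%N *: symbol (u * v) +
  symbol u * (symbol f - (symbol f 0%N)%:A) * symbol v.

Definition factorizes f := forall u v, symbol (u * f * v) = factorized f u v.

Lemma factorized_operator u v : bounded_operator (fun f => factorized f u v).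
Proof.
apply: bounded_operatorD.
  by apply: bounded_operator_scale; exact: symbol_functional.
apply: bounded_operator_mulr; apply: bounded_operator_mull.
have -> : (fun f => symbol f - (symbol f 0%N)%:A) =
    fun f => symbol f + symbol f 0%N *: (-1 : powser R).
  by apply/funext => f; rewrite scalerN.
apply: bounded_operatorD; first exact: symbol_operator.
by apply: bounded_operator_scale; exact: symbol_functional.
Qed.

Lemma factorized_operatorl f v : bounded_operator (fun u => factorized f u v).
Proof.
apply: bounded_operatorD.
  have -> : (fun u => symbol f 0%N *: symbol (u * v)) =
      fun u => symbol (1 * u * v) * (symbol f 0%N)%:A.
    by apply/funext => u; rewrite mul1r -scalerAr mulr1.
  by apply: bounded_operator_mulr; apply: bounded_operator_insert; exact: symbol_operator.
by do 2 apply: bounded_operator_mulr; exact: symbol_operator.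
Qed.

Lemma factorized_operatorr f u : bounded_operator (fun v => factorized f u v).
Proof.
apply: bounded_operatorD.
  have -> : (fun v => symbol f 0%N *: symbol (u * v)) =
      fun v => symbol (u * v * 1) * (symbol f 0%N)%:A.
    by apply/funext => v; rewrite -scalerAr !mulr1.
  by apply: bounded_operator_mulr; apply: bounded_operator_insert; exact: symbol_operator.
by apply: bounded_operator_mull; exact: symbol_operator.
Qed.

(** Both sides are separately bounded in [u] and in [v], hence determined by
words. *)
Lemma factorizes_monomials f : (forall w w',
    symbol (monomial w * f * monomial w') = factorized f (monomial w) (monomial w')) ->
  factorizes f.
Proof.
move=> ffw u v.
apply: (bounded_operator_eq (Phi := fun u => symbol (u * f * v))
  (Psi := fun u => factorized f u v)) => [||w _].
- have -> : (fun u => symbol (u * f * v)) = fun u => symbol (1 * u * (f * v)).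
    by apply/funext => x; rewrite mul1r mulrA.
  by apply: bounded_operator_insert; exact: symbol_operator.
- exact: factorized_operatorl.
apply: (bounded_operator_eq (Phi := fun v => symbol (monomial w * f * v))
  (Psi := fun v => factorized f (monomial w) v)) => [||w' _]; last exact: ffw.
- have -> : (fun v => symbol (monomial w * f * v)) =
      fun v => symbol (monomial w * f * v * 1).
    by apply/funext => x; rewrite mulr1.
  by apply: bounded_operator_insert; exact: symbol_operator.
- exact: factorized_operatorr.
Qed.

Lemma factorizes_series f :
  (forall w, val f w != 0 -> factorizes (monomial w)) -> factorizes f.
Proof.
move=> ff u v; apply: (bounded_operator_eq (Phi := fun f => symbol (u * f * v))
  (Psi := fun f => factorized f u v)) => [||w fw].
- by apply: bounded_operator_insert; exact: symbol_operator.
- exact: factorized_operator.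
- exact: ff.
Qed.

Lemma factorizes1 : factorizes 1.
Proof.
by move=> u v; rewrite /factorized symbol1 mulr1 !scale1r subrr mulr0 mul0r addr0.
Qed.

Lemma factorizes_block n k : (0 < n)%N -> factorizes (monomial (block n k)).
Proof.
move=> n0; apply: factorizes_monomials => w w'.
rewrite symbol_insert /factorized.
have -> : symbol (monomial (block n k)) 0%N = 0.
  rewrite symbol_monomial word_degree_block.
  transitivity ((word_value gamma None (block n k))%:C%C * (0%N == n)%:R) => //.
  by rewrite eq_sym eqn0Ngt n0 mulr0.
by rewrite !scale0r add0r subr0.
Qed.

Lemma factorizes_linear k f g : factorizes f -> factorizes g -> factorizes (k *: f + g).
Proof.
move=> ff fg u v; apply/funext => n.
rewrite mulrDr mulrDl -scalerAr -scalerAl symbol_linear ff fg.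
by have [lin _] := factorized_operator u v n; rewrite lin.
Qed.

Lemma factorizes0 : factorizes 0.
Proof.
by have := factorizes_linear (-1) factorizes1 factorizes1; rewrite scaleN1r addNr.
Qed.

Lemma factorizesD f g : factorizes f -> factorizes g -> factorizes (f + g).
Proof. by move=> ff fg; have := factorizes_linear 1 ff fg; rewrite scale1r. Qed.

Lemma factorizesZ k f : factorizes f -> factorizes (k *: f).
Proof. by move=> ff; have := factorizes_linear k ff factorizes0; rewrite addr0. Qed.

Lemma factorizesB f g : factorizes f -> factorizes g -> factorizes (f - g).
Proof. by move=> ff fg; rewrite -scaleN1r addrC; exact: factorizes_linear. Qed.

Lemma factorizes_symbolMr f v : factorizes f -> symbol (f * v) = symbol f * symbol v.
Proof.
move=> ff; have := ff 1 v; rewrite !mul1r => ->.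
by rewrite /factorized symbol1 !mul1r mulrBl -scalerAl mul1r addrC subrK.
Qed.

Lemma factorizes_mul f g : factorizes f -> factorizes g -> factorizes (f * g).
Proof.
move=> ff fg u v.
have fg0 : symbol (f * g) 0%N = symbol f 0%N * symbol g 0%N.
  rewrite factorizes_symbolMr//.
  transitivity (\sum_(i < 1) symbol f i * symbol g (0 - i)%N) => //.
  by rewrite big_ord1.
have -> : u * (f * g) * v = u * f * (g * v) by rewrite !mulrA.
rewrite ff /factorized [u * (g * v)]mulrA fg /factorized fg0.
rewrite (factorizes_symbolMr v fg) (factorizes_symbolMr g ff).
rewrite scalerDr scalerA -addrA; congr (_ + _).
have <- : symbol f 0%N *: (symbol g - (symbol g 0%N)%:A) +
    (symbol f - (symbol f 0%N)%:A) * symbol g =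
    symbol f * symbol g - (symbol f 0%N * symbol g 0%N)%:A.
  by rewrite scalerBr scalerA mulrBl -scalerAl mul1r addrC addrA subrK.
by rewrite [in RHS]mulrDr [in RHS]mulrDl -[in RHS]scalerAr -[in RHS]scalerAl !mulrA.
Qed.

(** The null ideal is the kernel of the symbol among factorizing elements. *)
Lemma null_factorizes f : null f -> factorizes f.
Proof.
move=> nf u v; have f0 : symbol f = 0 by have := nf 1 1; rewrite mul1r mulr1.
by rewrite nf /factorized f0 [0 0%N]/0 !scale0r subr0 mulr0 mul0r addr0.
Qed.

Lemma factorizes_null f : factorizes f -> symbol f = 0 -> null f.
Proof.
move=> ff f0 u v.
by rewrite ff /factorized f0 [0 0%N]/0 !scale0r subr0 mulr0 mul0r addr0.
Qed.

Lemma null_symbol f : null f -> symbol f = 0.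
Proof. by move=> nf; have := nf 1 1; rewrite mul1r mulr1. Qed.

Lemma closed_null : closed [set f | null f].
Proof.
have -> : [set f | null f] =
    \bigcap_(z in [set: F * F]) [set f | symbol (z.1 * f * z.2) = 0].
  apply/seteqP; split=> f /=; first by move=> nf z _; exact: nf.
  by move=> nf u v; exact: (nf (u, v)).
apply: closed_bigI => -[u v] _ /=.
apply: (closed_equalizer (Phi := fun f => symbol (u * f * v)) (Psi := fun=> 0)).
  by apply: bounded_operator_insert; exact: symbol_operator.
move=> n; split=> [k f g|]; first by rewrite mulr0 addr0.
by exists 1%:pos, 0 => f; rewrite Normc.normc0 mul0r.
Qed.

Lemma closed_factorizes : closed [set f | factorizes f].
Proof.
have -> : [set f | factorizes f] =
    \bigcap_(z in [set: F * F]) [set f | symbol (z.1 * f * z.2) = factorized f z.1 z.2].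
  apply/seteqP; split=> f /=; first by move=> nf z _; exact: nf.
  by move=> nf u v; exact: (nf (u, v)).
apply: closed_bigI => -[u v] _ /=.
apply: (closed_equalizer (Phi := fun f => symbol (u * f * v))
  (Psi := fun f => factorized f u v)); last exact: factorized_operator.
by apply: bounded_operator_insert; exact: symbol_operator.
Qed.

Definition null_ideal : {pred F} := fun f => `[< null f >].

Lemma null_ideal_idealr : idealr_closed null_ideal.
Proof.
split.
- by apply/asboolP => u v; rewrite mulr0 mul0r symbol0.
- apply/asboolPn => n1; have := null_symbol n1; rewrite symbol1.
  by move/eqP; rewrite oner_eq0.
- move=> a f g /asboolP nf /asboolP ng; apply/asboolP => u v.
  by rewrite mulrDr mulrDl symbolD ng mulrA nf addr0.
Qed.

HB.instance Definition _ := isIdealr.Build F null_ideal null_ideal_idealr.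

Lemma null_ideal_mulr a : {in null_ideal, forall f, f * a \in null_ideal}.
Proof.
move=> f /asboolP nf; apply/asboolP => u v.
by rewrite mulrA -mulrA nf.
Qed.

HB.instance Definition _ := isRightIdeal.Build F null_ideal null_ideal_mulr.

Lemma null_ideal_closed : closed [set` null_ideal].
Proof.
have -> : [set` null_ideal] = [set f | null f].
  by apply/seteqP; split=> f /asboolP.
exact: closed_null.
Qed.

Local Notation Q := (quotient_algebra null_ideal).
Local Notation pi := (quotient_map null_ideal).

Lemma quotient_map_null f g : pi f = pi g -> null (f - g).
Proof. by move/quotient_map_eq/asboolP. Qed.

Definition symbol_subalgebra : {pred Q} :=
  fun x => `[< exists2 f, pi f = x & factorizes f >].

(** Membership does not depend on the representative, as null elements
factorize. *)
Lemma symbol_subalgebraP f : (pi f \in symbol_subalgebra) <-> factorizes f.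
Proof.
split=> [/asboolP[g gf fg]|ff]; last by apply/asboolP; exists f.
rewrite -[f](subrK g); apply: factorizesD => //.
by apply/null_factorizes/quotient_map_null.
Qed.

Lemma symbol_subalgebra_closed : GRing.subsemialg_closed symbol_subalgebra.
Proof.
split.
- by apply/asboolP; exists 1 => //; exact: factorizes1.
- split=> [|_ _ /asboolP[f <- ff] /asboolP[g <- fg]]; apply/asboolP.
    by exists 0; [exact: quotient_map0|exact: factorizes0].
  by exists (f + g); [exact: quotient_mapD|exact: factorizesD].
- move=> k _ /asboolP[f <- ff]; apply/asboolP.
  by exists (k *: f); [exact: quotient_mapZ|exact: factorizesZ].
- move=> _ _ /asboolP[f <- ff] /asboolP[g <- fg]; apply/asboolP.
  by exists (f * g); [exact: quotient_mapM|exact: factorizes_mul].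
Qed.

HB.instance Definition _ :=
  GRing.isSubalgClosed.Build R[i] Q symbol_subalgebra symbol_subalgebra_closed.

(** In the quotient topology it suffices that the inverse image is closed. *)
Lemma closed_symbol_subalgebra : closed [set` symbol_subalgebra].
Proof.
rewrite -openC; change (open (pi @^-1` (~` [set` symbol_subalgebra]))).
have -> : pi @^-1` (~` [set` symbol_subalgebra]) = ~` [set f | factorizes f].
  by apply/seteqP; split=> f /= nf ff; apply: nf; apply/symbol_subalgebraP.
by rewrite openC; exact: closed_factorizes.
Qed.

End SymbolAlgebra.

(** * Lifting power series and the embedding *)

Section CanonicalLifts.
Context {R : realType} (D : blockSystem R).
Local Notation F := (freeEntire R 4).
Local Notation word := (seq 'I_4).
Local Notation gamma := (bs_gamma D).

(** The word chosen to represent the [n]-th power of y. The zeroth power is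
the unit and is represented by the empty word. *)
Definition lift_word (k : nat -> nat) (n : nat) : word :=
  if n is 0 then [::] else block n (k n).

(** The norm of radius [rho] of [lift_word k n] divided by its value. *)
Definition lift_weight (rho : R) (k : nat -> nat) (n : nat) : R :=
  if n is 0 then 1 else rho ^+ (n + k n).+2 / gamma n (k n).

Lemma word_degree_lift k n : word_degree (lift_word k n) = n.
Proof. by case: n => // n; rewrite /lift_word word_degree_block. Qed.

Lemma word_value_lift_gt0 k n : 0 < word_value gamma None (lift_word k n).
Proof.
case: n => [|n]; first exact: ltr01.
by rewrite /lift_word -[block _ _]cats0 word_value_block mulr1 bs_gamma_gt0.
Qed.

Lemma lift_weightE rho k n : lift_weight rho k n =
  rho ^+ size (lift_word k n) / word_value gamma None (lift_word k n).
Proof.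
case: n => [|n]; first by rewrite expr0 invr1 mulr1.
by rewrite /lift_word -[block _ _ in RHS]cats0 word_value_block mulr1 cats0 size_block.
Qed.

Definition lift_series (k : nat -> nat) (a : powser R) : freeSeries R 4 :=
  fun w => if w == lift_word k (word_degree w)
    then a (word_degree w) / (word_value gamma None w)%:C%C else 0.

Lemma free_norm_lift rho k a : 0 < rho ->
  free_norm rho (lift_series k a) = wsum (lift_weight rho k) a.
Proof.
move=> rho0; rewrite /wsum.
have kinj : set_inj [set: nat] (lift_word k).
  by move=> n n' _ _ /(congr1 word_degree); rewrite !word_degree_lift.
pose t (w : word) := (normc (lift_series k a w) * rho ^+ size w)%:E.
transitivity (\esum_(n in [set: nat]) t (lift_word k n))%E.
  rewrite -(@esum_image _ _ _ _ _ t kinj) [RHS]esum_mkcond; apply: eq_esum => w _.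
  case: ifPn => // /negP wk; rewrite /lift_series; case: eqP => [wE|_].
    by case: wk; apply/mem_set; exists (word_degree w).
  by rewrite Normc.normc0 mul0r.
apply: eq_esum => n _; rewrite /t /lift_series word_degree_lift eqxx lift_weightE.
rewrite Normc.normcM Normc.normcV normc_real ?(ltW (word_value_lift_gt0 _ _))//.
by rewrite mulrAC mulrA.
Qed.

(** Both claims on the symbol hold for words in the support of the lift and
extend by density. *)
Lemma lift_exists k (a : powser R) :
  (forall rho, 0 < rho -> (wsum (lift_weight rho k) a < +oo)%E) ->
  exists f : F, [/\ symbol D f = a, factorizes D f &
    forall rho, (freeEntire_norm rho f)%:E = wsum (lift_weight rho%:num k) a].
Proof.
move=> aoo.
have af : free_entire (lift_series k a).
  by apply/asboolP => rho rho0; rewrite free_norm_lift// aoo.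
exists (exist _ (lift_series k a) af : F); set f : F := exist _ _ _.
have fE w : val f w = lift_series k a w by [].
have supp w : val f w != 0 -> w = lift_word k (word_degree w).
  rewrite fE /lift_series.
  by have [wE //|_] := eqVneq w (lift_word k (word_degree w)); rewrite eqxx.
split.
- have aE : a = fun n => val f (lift_word k n) *
      (word_value gamma None (lift_word k n))%:C%C.
    apply/funext => n; rewrite fE /lift_series word_degree_lift eqxx divfK//.
    by rewrite -(rmorph0 (real_complex R)) (inj_eq (@complexI R)) gt_eqF// word_value_lift_gt0.
  rewrite [RHS]aE; apply: (bounded_operator_eq (Phi := symbol D)
    (Psi := fun f n => val f (lift_word k n) *
      (word_value gamma None (lift_word k n))%:C%C)) => [|n|w /supp ->].
  + exact: symbol_operator.
  + apply: bounded_functionalZ; split=> [c x y|].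
      by rewrite freeEntireDE freeEntireZE.
    exists 1%:pos, 1 => x; rewrite mul1r; apply: le_trans (freeEntire_coef_le _ _ (lift_word k n)).
    by rewrite expr1n mulr1.
  + set p := word_degree w; apply/funext => n; rewrite symbol_monomial word_degree_lift.
    transitivity ((word_value gamma None (lift_word k p))%:C%C * (n == p)%:R) => //.
    rewrite monomialE; have [->|np] := eqVneq n p; first by rewrite eqxx mulr1 mul1r.
    rewrite mulr0; case: eqP => [/(congr1 word_degree)|]; last by rewrite mul0r.
    by rewrite !word_degree_lift => /eqP; rewrite (negPf np).
- apply: factorizes_series => w /supp ->; case: (word_degree w) => [|n].
    by rewrite /lift_word monomial_nil; exact: factorizes1.
  exact: factorizes_block.
- by move=> rho; rewrite freeEntire_normE -free_norm_lift.
Qed.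

End CanonicalLifts.

Section Embedding.
Context {R : realType} (D : blockSystem R) (A : preTopologicalAlgType R[i]).
Variables (coef : A -> powser R) (p : bs_index D -> A -> R).
Hypothesis coef_inj : injective coef.
Hypothesis coef_linear : forall k a b, coef (k *: a + b) = k *: coef a + coef b.
Hypothesis coefM : forall a b, coef (a * b) = coef a * coef b.
Hypothesis coef1 : coef 1 = 1.
Hypothesis pE : forall i a, (p i a)%:E = wsum (@bs_weight R D i) (coef a).
Hypothesis coef_range : forall x : powser R,
  (forall i, (wsum (@bs_weight R D i) x < +oo)%E) -> exists a, coef a = x.
Hypothesis pA : generates_topology p.
Hypothesis lift_bound : forall rho : {posnum R}, exists i C,
  forall a (e : R), 0 < e -> exists k : nat -> nat,
    (forall r : R, 0 < r -> (wsum (lift_weight D r k) (coef a) < +oo)%E) /\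
    (wsum (lift_weight D rho%:num k) (coef a) <= (C * p i a + e)%:E)%E.

Local Notation F := (freeEntire R 4).
Local Notation Q := (quotient_algebra (null_ideal D)).
Local Notation pi := (quotient_map (null_ideal D)).
Local Notation S := (subalgebra (@symbol_subalgebra R D : subalgClosed Q)).

Lemma lift_small rho : exists i C, forall a (e : R), 0 < e ->
  exists f, [/\ symbol D f = coef a, factorizes D f &
    freeEntire_norm rho f <= C * p i a + e].
Proof.
have [i [C lb]] := lift_bound rho; exists i, C => a e e0.
have [k [koo kC]] := lb a e e0.
have [f [fa ff fn]] := lift_exists koo.
by exists f; split=> //; rewrite -lee_fin fn.
Qed.

Lemma lift_any a : exists2 f, symbol D f = coef a & factorizes D f.
Proof.
have [i [C lb]] := lift_small 1%:pos.
by have [f [fa ff _]] := lb a 1 ltr01; exists f.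
Qed.

Lemma symbol_in_range f : exists a, coef a = symbol D f.
Proof.
apply: coef_range => i; have [rho b] := symbol_bound i.
by apply: le_lt_trans (b f) _; rewrite ltry.
Qed.

(** A map on classes: two factorizing lifts of the same power series differ by
a null element. *)
Lemma embedding_exists : exists emb : A -> S, forall a f,
  symbol D f = coef a -> factorizes D f -> pi f = val (emb a).
Proof.
have /choice[lf lfE] : forall a, exists f, symbol D f = coef a /\ factorizes D f.
  by move=> a; have [f fa ff] := lift_any a; exists f.
have lfS a : pi (lf a) \in (@symbol_subalgebra R D : subalgClosed Q).
  by apply/symbol_subalgebraP; exact: (lfE a).2.
exists (fun a => exist _ (pi (lf a)) (lfS a) : S) => a f fa ff /=.
apply/quotient_map_eq; apply/asboolP; apply: factorizes_null.
  by apply: factorizesB => //; exact: (lfE a).2.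
by rewrite symbolB fa (lfE a).1 subrr.
Qed.

Lemma restriction_exists : exists res : S -> A, forall x f,
  pi f = val x -> coef (res x) = symbol D f.
Proof.
have /choice[res resE] : forall x : S, exists a, forall f, pi f = val x -> coef a = symbol D f.
  move=> x; have [f fx] := quotient_map_surj (val x).
  have [a af] := symbol_in_range f; exists a => g gx; rewrite af.
  apply/eqP; rewrite -subr_eq0 -symbolB; apply/eqP/null_symbol/quotient_map_null.
  by rewrite fx gx.
by exists res.
Qed.

Lemma subalgebra_lift (x : S) : exists2 f, pi f = val x & factorizes D f.
Proof. by have /asboolP := valP x. Qed.

Lemma near_subalgebra (x : S) rho e : 0 < e ->
  nbhs x [set y : S | quotient_norm rho ((val y : Q) - (val x : Q)) < e].
Proof.
move=> e0; have /initial_continuous xnear := near_seminorm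
  (@quotient_norm_topology _ _ (null_ideal D)) (val x) rho e0.
exact: xnear.
Qed.

Lemma coefB a b : coef (a - b) = coef a - coef b.
Proof. by rewrite addrC -scaleN1r coef_linear scaleN1r addrC. Qed.

Lemma restriction_continuous (res : S -> A) :
  (forall x f, pi f = val x -> coef (res x) = symbol D f) -> continuous res.
Proof.
move=> resE x; apply: (cvg_seminorm pA (nbhs_filter (x : S))) => i e e0.
have [rho b] := symbol_bound i.
have e2 : 0 < e / 2 by rewrite divr_gt0.
apply: filterS (near_subalgebra x rho e2) => y /quotient_norm_lt[h hxy hn].
rewrite -lte_fin pE coefB.
have [u uy _] := subalgebra_lift y; have [v vx _] := subalgebra_lift x.
have -> : coef (res y) - coef (res x) = symbol D h.
  rewrite (resE y u)// (resE x v)// -symbolB.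
  apply/eqP; rewrite -subr_eq0 -symbolB; apply/eqP/null_symbol/quotient_map_null.
  by rewrite quotient_mapB uy vx hxy.
apply: le_lt_trans (b h) _; rewrite lte_fin.
by rewrite mulrC -ltr_pdivlMr.
Qed.

Theorem symbol_subalgebra_iso :
  top_alg_iso A (subalgebra (@symbol_subalgebra R D : subalgClosed Q)).
Proof.
have [emb embE] := embedding_exists; have [res resE] := restriction_exists.
have resK : cancel res emb.
  move=> x; have [f fx ff] := subalgebra_lift x; apply: val_inj.
  by rewrite -(embE _ f)// -(resE x).
have embK : cancel emb res.
  move=> a; have [f fa ff] := lift_any a; apply: coef_inj.
  by rewrite (resE _ f) ?(embE a f).
have coefD a b : coef (a + b) = coef a + coef b.
  by have := coef_linear 1 a b; rewrite !scale1r.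
have coef0 : coef 0 = 0 by apply: (@addrI _ (coef 0)); rewrite -coefD !addr0.
have coefZ k a : coef (k *: a) = k *: coef a.
  by have := coef_linear k a 0; rewrite coef0 !addr0.
have valP k (x y : S) : val (k *: x + y) = k *: val x + val y.
  by rewrite linearP.
have valM (x y : S) : val (x * y) = val x * val y by rewrite rmorphM.
have val1 : val (1 : S) = 1 by rewrite rmorph1.
have emb_linear : linear emb.
  move=> k a b; apply: val_inj; have [f fa ff] := lift_any a.
  have [g gb gg] := lift_any b.
  rewrite valP -(embE a f)// -(embE b g)// -quotient_mapZ -quotient_mapD.
  apply/esym/embE; first by rewrite symbol_linear coef_linear fa gb.
  exact: factorizes_linear.
have emb_mul : monoid_morphism emb.
  split.
    apply: val_inj; rewrite val1 -(embE 1 1)//; last exact: factorizes1.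
    by rewrite symbol1.
  move=> a b; apply: val_inj; have [f fa ff] := lift_any a.
  have [g gb gg] := lift_any b.
  rewrite valM -(embE a f)// -(embE b g)// -quotient_mapM.
  apply/esym/embE; last exact: factorizes_mul.
  by rewrite factorizes_symbolMr// coefM fa gb.
pose embL := GRing.isLinear.Build R[i] A S *:%R emb emb_linear.
pose embM := GRing.isMonoidMorphism.Build A S emb emb_mul.
pose f : {lrmorphism A -> S} := HB.pack emb embL embM.
exists f, res; split=> //.
- apply/continuous_comp_initial => a.
  apply: (cvg_seminorm (@quotient_norm_topology _ _ (null_ideal D))) => rho e e0.
  have [i [C lb]] := lift_small rho.
  have C1 : 0 < `|C| + 1 by rewrite ltr_wpDl.
  have e2 : 0 < e / 2 by rewrite divr_gt0.
  near=> b.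
  have [h [hb hh hn]] := lb (b - a) _ e2.
  have -> : val (emb b) - val (emb a) = pi h.
    have [u ub uu] := lift_any b; have [v va vv] := lift_any a.
    rewrite -(embE b u)// -(embE a v)// -quotient_mapB.
    apply/quotient_map_eq/asboolP/factorizes_null.
      by do 2 apply: factorizesB => //.
    by rewrite !symbolB ub va hb coefB subrr.
  apply: le_lt_trans (quotient_norm_le _ _ _) _; apply: le_lt_trans hn _.
  have p0 : 0 <= p i (b - a).
    by rewrite -lee_fin pE wsum_ge0// => n; exact: bs_weight_ge0.
  have : p i (b - a) < e / 2 / (`|C| + 1).
    by near: b; apply: (near_seminorm pA); rewrite divr_gt0.
  rewrite ltr_pdivlMr// => pe; rewrite -ltrBrDr {1}(splitr e) addrK.
  apply: le_lt_trans pe; rewrite mulrC ler_wpM2l//.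
  by apply: le_trans (ler_norm _) _; rewrite lerDl.
- exact: restriction_continuous.
Unshelve. all: by end_near. Qed.

Theorem block_embedding : exists (B : lcAlgType R[i]) (T : subalgClosed B),
  [/\ hfg B, closed [set` T] & top_alg_iso A (subalgebra T)].
Proof.
exists Q, (@symbol_subalgebra R D : subalgClosed Q); split.
- by apply: quotient_hfg; exact: null_ideal_closed.
- exact: closed_symbol_subalgebra.
- exact: symbol_subalgebra_iso.
Qed.

End Embedding.

(** * The two families of blocks *)

Section WeightedSumBounds.
Context {R : realType} {T : choiceType}.

Lemma wsum_le_lin (C e : R) (V W : T -> R) (c : T -> R) (a : T -> R[i]) :
  0 <= C -> (forall t, 0 <= W t) -> (forall t, 0 <= c t) ->
  (\esum_(t in [set: T]) (c t)%:E <= e%:E)%E ->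
  (forall t, normc (a t) * V t <= C * (normc (a t) * W t) + c t) ->
  (wsum V a <= C%:E * wsum W a + e%:E)%E.
Proof.
move=> C0 W0 c0 ce VW.
have aW0 t : (0 <= (normc (a t) * W t)%:E)%E by rewrite lee_fin mulr_ge0 ?normc_ge0.
apply: le_trans (leeD (lexx _) ce); rewrite /wsum -esumZl// -esumD.
- by apply: le_esum => t _; rewrite -EFinM -EFinD lee_fin.
- by move=> t _; rewrite mule_ge0.
- by move=> t _; rewrite lee_fin.
Qed.

End WeightedSumBounds.

Section FiniteOrder.
Context {R : realType} (s : {nonneg R}).

Definition factorial_power (n k : nat) : R := n`!%:R `^ s%:num.

Lemma factorial_power_gt0 n k : 0 < factorial_power n k.
Proof. by rewrite powR_gt0// ltr0n fact_gt0. Qed.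

Lemma factorial_powerM n p k :
  factorial_power n k * factorial_power p k <= factorial_power (n + p) k.
Proof.
rewrite /factorial_power -powRM ?ler0n// -natrM ge0_ler_powR ?nnegrE ?ler0n//.
by rewrite ler_nat -(bin_fact (leq_addr p n)) addKn leq_pmull// bin_gt0 leq_addr.
Qed.

(** Splitting [n] degree letters among blocks can only decrease the product of
factorials. *)
Lemma factorial_power_word w :
  word_value factorial_power None w <= factorial_power (word_degree w) 0.
Proof.
suff h q : word_value factorial_power q w <=
    factorial_power (word_degree w + (if q is Some nk then nk.1 else 0)) 0.
  by rewrite -[word_degree w]addn0; exact: (h None).
elim: w q => [|x w IH] [[n k]|] /=; try exact/ltW/factorial_power_gt0.
- by rewrite /factorial_power fact0 powR1.
- rewrite /word_degree /= -/(word_degree w).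
  case: ifP => _.
    by apply: le_trans (IH _) _; rewrite /= add1n addSnnS.
  rewrite add0n; case: ifP => _; first exact: IH.
  case: ifP => _; last exact/ltW/factorial_power_gt0.
  apply: le_trans (ler_wpM2l _ (IH None)) _; first exact/ltW/factorial_power_gt0.
  by rewrite addn0 addnC; exact: factorial_powerM.
- rewrite /word_degree /= -/(word_degree w).
  by case: ifP => [/eqP->|_]; [exact: IH|exact/ltW/factorial_power_gt0].
Qed.

Lemma factorial_bound (r : {posnum R}) : exists rho : {posnum R}, forall w,
  word_value factorial_power None w * weight s%:num r%:num (word_degree w) <=
  rho%:num ^+ size w.
Proof.
exists (1 + r%:num)%:pos => w.
have f0 := factorial_power_gt0 (word_degree w) 0.
apply: (@le_trans _ _ (r%:num ^+ word_degree w)).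
  rewrite /weight mulrA ler_pdivrMr// mulrC ler_wpM2l ?exprn_ge0//.
  exact: factorial_power_word.
apply: (@le_trans _ _ ((1 + r%:num) ^+ word_degree w)).
  by rewrite lerXn2r ?nnegrE ?addr_ge0// lerDr.
by apply: ler_weXn2l; [rewrite lerDl|exact: count_size].
Qed.

Definition factorial_system : blockSystem R := {|
  bs_index := {posnum R};
  bs_weight := fun r => weight s%:num r%:num;
  bs_gamma := factorial_power;
  bs_weight_ge0 := fun r n => weight_ge0 s%:num n (gt0 r);
  bs_weight_gt0 := fun n => ex_intro _ 1%:pos
    (divr_gt0 (exprn_gt0 n ltr01) (factorial_power_gt0 n 0));
  bs_gamma_gt0 := factorial_power_gt0;
  bs_bound := factorial_bound |}.

(** The block of [n] degree letters alone has norm [rho ^+ n.+2] and value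
the [s]-th power of [n] factorial: up to [rho ^+ 2], due to the delimiters, the
quotient is the weight of [Afin_norm rho]. *)
Lemma factorial_lift (rho : {posnum R}) : exists (r : {posnum R}) C,
  forall (a : Afin s) (e : R), 0 < e -> exists k : nat -> nat,
    (forall r' : R, 0 < r' ->
      (wsum (lift_weight factorial_system r' k) (val a) < +oo)%E) /\
    (wsum (lift_weight factorial_system rho%:num k) (val a) <=
      (C * Afin_norm r a + e)%:E)%E.
Proof.
exists rho, (1 + rho%:num ^+ 2) => a e e0; exists (fun=> 0%N).
have bound (r : {posnum R}) : (wsum (lift_weight factorial_system r%:num (fun=> 0%N)) (val a) <=
    ((1 + r%:num ^+ 2) * Afin_norm r a)%:E)%E.
  rewrite EFinM /Afin_norm weighted_normE// fineK ?Afin_norm_fin// -[leRHS]adde0.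
  apply: (wsum_le_lin (c := fun=> 0)) => //.
  - by move=> n; exact: weight_ge0.
  - by rewrite esum1.
  move=> n; rewrite addr0 mulrCA ler_wpM2l ?normc_ge0//.
  case: n => [|n]; rewrite /lift_weight /weight /=.
    by rewrite fact0 powR1 expr0 divr1 mulr1 lerDl exprn_ge0.
  rewrite addn0 -/(factorial_power n.+1 0) mulrA ler_pdivrMr ?factorial_power_gt0//.
  rewrite divfK ?gt_eqF ?factorial_power_gt0// -[n.+3]/(2 + n.+1)%N exprD.
  by rewrite ler_wpM2r ?exprn_ge0// lerDr.
split=> [r r0|]; first by apply: le_lt_trans (bound (PosNum r0)) _; rewrite ltry.
by apply: le_trans (bound rho) _; rewrite lee_fin lerDl ltW.
Qed.

Lemma finite_order_embedding : exists (B : lcAlgType R[i]) (S : subalgClosed B),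
  [/\ hfg B, closed [set` S] & top_alg_iso (Aalg (Some s)) (subalgebra S)].
Proof.
apply: (@block_embedding _ factorial_system (Afin s) val
  (fun r a => Afin_norm r a)) => //.
- by move=> r a; rewrite /Afin_norm weighted_normE// fineK// Afin_norm_fin.
- move=> x xoo; have xS : weighted_summable s x.
    by apply/asboolP => r r0; rewrite weighted_normE//; exact: (xoo (PosNum r0)).
  by exists (exist _ x xS : Afin s).
- exact: factorial_lift.
Qed.

End FiniteOrder.

Section InfiniteOrder.
Context {R : realType}.

(** [n ^ k], with 1 in place of [n = 0] to keep the values positive. *)
Definition degree_power (n k : nat) : R := (maxn n 1)%:R ^+ k.

Definition truncation (m n : nat) : R := (n <= m)%N%:R.

Lemma degree_power_gt0 n k : 0 < degree_power n k.
Proof. by rewrite exprn_gt0// ltr0n leq_max orbT. Qed.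

Lemma truncation_bound m : exists rho : {posnum R}, forall w,
  word_value degree_power None w * truncation m (word_degree w) <=
  rho%:num ^+ size w.
Proof.
have M0 : 0 < (maxn m 1)%:R :> R by rewrite ltr0n leq_max orbT.
have M1 : 1 <= (maxn m 1)%:R :> R by rewrite ler1n leq_max orbT.
exists (PosNum M0) => w; rewrite /truncation.
case: leqP => wm; last by rewrite mulr0 exprn_ge0.
rewrite mulr1 /=; set M := _%:R in M0 M1 *.
suff h q : (word_degree w + (if q is Some nk then nk.1 else 0) <= m)%N ->
    word_value degree_power q w <= M ^+ (size w + (if q is Some nk then nk.2 else 0)).
  by have := h None; rewrite !addn0; apply.
have M0' j : 0 <= M ^+ j by rewrite exprn_ge0// ltW.
elim: w q {wm} => [|x w IH] [[n k]|] //=.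
- rewrite /word_degree /= -/(word_degree w) => nm.
  case: ifP nm => _ nm.
    apply: le_trans (IH (Some (n.+1, k)) _) _; first by rewrite /= -addSnnS -add1n.
    by rewrite ler_weXn2l//= addSn.
  move: nm; rewrite add0n => nm; case: ifP => _.
    by apply: le_trans (IH (Some (n, k.+1)) nm) _; rewrite /= addnS addSn.
  case: ifP => _ //.
  apply: (@le_trans _ _ (M ^+ k * M ^+ size w)).
    apply: ler_pM; first exact/ltW/degree_power_gt0.
    + exact/word_value_ge0/degree_power_gt0.
    + rewrite /degree_power lerXn2r ?nnegrE ?ler0n// ler_nat geq_max.
      rewrite !leq_max leqnn orbT andbT; apply/orP; left.
      exact: leq_trans (leq_addl _ _) nm.
    + by have := IH None; rewrite !addn0; apply; apply: leq_trans (leq_addr _ _) nm.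
  by rewrite -exprD ler_weXn2l// addnC leq_add.
- rewrite /word_degree /= -/(word_degree w).
  case: ifP => [/eqP->|_] //= nm; apply: le_trans (IH (Some (0%N, 0%N)) nm) _.
  by rewrite !addn0 ler_weXn2l.
Qed.

Lemma truncation_ge0 m n : 0 <= truncation m n. Proof. by rewrite ler0n. Qed.

Lemma truncation_gt0 n : exists m, 0 < truncation m n.
Proof. by exists n; rewrite /truncation leqnn. Qed.

Definition degree_system : blockSystem R := {|
  bs_index := nat;
  bs_weight := truncation;
  bs_gamma := degree_power;
  bs_weight_ge0 := truncation_ge0;
  bs_weight_gt0 := truncation_gt0;
  bs_gamma_gt0 := degree_power_gt0;
  bs_bound := truncation_bound |}.

Lemma powser_normE m (a : powser R) :
  (powser_norm m a)%:E = wsum (truncation m) a.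
Proof.
rewrite /powser_norm /wsum.
transitivity (\esum_(n in `I_m.+1) (normc (a n))%:E)%E.
  rewrite esum_fset; [|exact: finite_II|by move=> n _; rewrite lee_fin normc_ge0].
  by rewrite -fsbig_ord sumEFin.
rewrite esum_mkcond; apply: eq_esum => n _; rewrite /truncation.
have -> : (n \in `I_m.+1) = (n <= m)%N by apply/idP/idP; rewrite inE.
by case: ifP; rewrite ?mulr1 ?mulr0.
Qed.

Lemma geometric_small (c q e : R) : 0 <= q < 1 -> 0 < e -> exists k, c * q ^+ k <= e.
Proof.
move=> /andP[q0 q1] e0.
have : (fun k => c * q ^+ k) @ \oo --> c * 0.
  by apply: cvgM; [exact: cvg_cst|apply: cvg_expr; rewrite ger0_norm].
rewrite mulr0 => /cvgr_le/(_ _ e0) [k _ h]; exists k; exact: h (leqnn k).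
Qed.

(** A block of degree [n] with [k] weight letters has norm [r ^+ (n + k).+2]
and value [n ^ k]. For [r <= n.-1] the quotient tends to 0 as [k] grows, so the
tail is made smaller than [e] while low degrees use no weight letter. Comparing
with [n.-1], which exceeds any given radius eventually, makes the same lift
converge for every radius. *)
Lemma degree_lift (rho : {posnum R}) : exists (m : nat) (C : R),
  forall (a : powser R) (e : R), 0 < e -> exists k : nat -> nat,
    (forall r : R, 0 < r ->
      (wsum (lift_weight degree_system r k) a < +oo)%E) /\
    (wsum (lift_weight degree_system rho%:num k) a <=
      (C * powser_norm m a + e)%:E)%E.
Proof.
have [m rhom] : exists m, rho%:num <= m.+1%:R.
  have [m rm] := posnum_bound [:: rho]; exists m; exact: rm (mem_head _ _).
exists m.+1, (\sum_(n < m.+2) lift_weight degree_system rho%:num (fun=> 0%N) n) => a e e0.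
have /choice[k kP] : forall n, exists k : nat, (n <= m.+1)%N /\ k = 0%N \/
    (m.+1 < n)%N /\
    normc (a n) * (n.-1%:R ^+ (n + k).+2 / degree_power n k) <= e * 2^-1 ^+ n.+1.
  move=> n; have [nm|nm] := leqP n m.+1; first by exists 0%N; left.
  have n0 : 0 < n%:R :> R by rewrite ltr0n (leq_trans _ nm).
  have q01 : 0 <= (n.-1%:R / n%:R : R) < 1.
    rewrite divr_ge0 ?ler0n//= ltr_pdivrMr// mul1r ltr_nat prednK// (leq_trans _ nm)//.
  have e1 : 0 < e * 2^-1 ^+ n.+1 by rewrite mulr_gt0// exprn_gt0.
  have [k hk] := geometric_small (normc (a n) * n.-1%:R ^+ n.+2) q01 e1.
  exists k; right; split=> //; apply: le_trans hk.
  rewrite /degree_power (maxn_idPl _) ?(leq_trans _ nm)//.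
  by rewrite exprMn exprVn -addSn -addSn exprD !mulrA.
pose K N r := \sum_(n < N.+1) lift_weight degree_system r k n.
have lift0 r n : 0 < r -> 0 <= lift_weight degree_system r k n.
  move=> r0; case: n => // n.
  by rewrite divr_ge0 ?exprn_ge0 ?(ltW r0)//; exact/ltW/degree_power_gt0.
have bound N r : 0 < r -> (m.+1 <= N)%N -> r <= N%:R ->
    (wsum (lift_weight degree_system r k) a <= (K N r * powser_norm N a + e)%:E)%E.
  move=> r0 mN rN; rewrite EFinD EFinM powser_normE.
  apply: (wsum_le_lin (c := fun n => e * 2^-1 ^+ n.+1)).
  - by apply: sumr_ge0 => n _; exact: lift0.
  - exact: truncation_ge0.
  - by move=> n; rewrite mulr_ge0 ?exprn_ge0// ltW.
  - have := @esum_half_power R 0; under eq_esum do rewrite add0n.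
    under [X in (_ -> X <= _)%E]eq_esum do rewrite EFinM.
    rewrite esumZl; [move=> h|exact: ltW|by move=> n; rewrite lee_fin exprn_ge0].
    have e0' : (0 <= e%:E)%E by rewrite lee_fin ltW.
    by apply: le_trans (lee_wpmul2l e0' h) _; rewrite expr0 mule1.
  move=> n; rewrite /truncation; case: leqP => nN.
    rewrite mulr1 -[leLHS]addr0; apply: lerD; last by rewrite mulr_ge0 ?exprn_ge0// ltW.
    rewrite mulrC ler_wpM2r ?normc_ge0// /K.
    by rewrite (bigD1 (Ordinal (nN : (n < N.+1)%N)))//= lerDl sumr_ge0// => i _; exact: lift0.
  rewrite !mulr0 add0r; case: (kP n) => [[nm _]|[nm h]].
    by move: nN; rewrite ltnNge (leq_trans nm mN).
  apply: le_trans h; rewrite ler_wpM2l ?normc_ge0//.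
  case: n nm nN => // n nm nN; rewrite /lift_weight ler_wpM2r//.
    by rewrite invr_ge0; exact/ltW/degree_power_gt0.
  by rewrite lerXn2r ?nnegrE ?ler0n ?(ltW r0)// (le_trans rN)// ler_nat.
exists k; split=> [r r0|].
  have r1 : r <= (m.+1 + (Num.truncn r).+1)%:R.
    have /andP[_ /ltW/le_trans] := truncn_itv (ltW r0); apply.
    by rewrite ler_nat leq_addl.
  by apply: le_lt_trans (bound _ _ r0 (leq_addr _ _) r1) _; rewrite ltry.
suff -> : \sum_(n < m.+2) lift_weight degree_system rho%:num (fun=> 0%N) n =
    K m.+1 rho%:num by exact: bound.
apply: eq_bigr => n _.
rewrite /lift_weight; case: (n : nat) (ltn_ord n) => // j jm.
by case: (kP j.+1) => [[_ ->]//|[]]; rewrite ltnNge -ltnS jm.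
Qed.

Lemma infinite_order_embedding : exists (B : lcAlgType R[i]) (S : subalgClosed B),
  [/\ hfg B, closed [set` S] & top_alg_iso (Aalg None) (subalgebra S)].
Proof.
apply: (@block_embedding _ degree_system (powser R) id
  (fun m a => powser_norm m a)) => //.
- by move=> m a; exact: powser_normE.
- by move=> x _; exists x.
- exact: degree_lift.
Qed.

End InfiniteOrder.

Theorem theorem14 (R : realType) (s : option {nonneg R})
    (hs : if s is Some t then exists2 q : rat, 0 < q & t%:num = ratr q
          else True) :
  exists (B : lcAlgType R[i]) (S : subalgClosed B),
    [/\ hfg B, closed [set` S] & top_alg_iso (Aalg s) (subalgebra S)].
Proof.
case: s {hs} => [s|]; first exact: finite_order_embedding.
exact: infinite_order_embedding.
Qed.
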